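(* The space $\mathcal{X}$ of mm-isomorphism classes of mm-spaces is contractible both with respect to the box topology and with respect to the concentration topology. Moreover, the space $\Pi$ of pyramids is contractible with respect to the weak topology. In particular, all of these spaces are path connected and simply connected.
   Context: An mm-space is a triple $(X,d_X,\mu_X)$ with $(X,d_X)$ complete separable metric and $\mu_X$ a Borel probability measure; mm-isomorphism means an isometry between supports pushing $\mu_X$ to $\mu_Y$; $\mathcal{X}$ is the set of mm-isomorphism classes. A parameter of $X$ is a Borel map $\varphi\colon I=[0,1)\to X$ with $\varphi_*\mathcal{L}^1=\mu_X$. Box distance: $\square(X,Y)$ is the infimum of $\varepsilon\ge0$ such that there are parameters $\varphi,\psi$ of $X,Y$ and Borel $I_0\subset I$ with $\mathcal{L}^1(I_0)\ge1-\varepsilon$ and $|d_X(\varphi(s),\varphi(t))-d_Y(\psi(s),\psi(t))|\le\varepsilon$ for $s,t\in I_0$; it induces the box topology. Observable distance: $d_{\mathrm{conc}}(X,Y)=\inf_{\varphi,\psi}d_{\mathrm{H}}(\{f\circ\varphi\},\{g\circ\psi\})$ where $f,g$ range over real 1-Lipschitz functions on $X$, $Y$, and $d_{\mathrm{H}}$ is the Hausdorff distance for the Ky Fan metric $d_{\mathrm{KF}}(u,v)=\inf\{\varepsilon\ge0:\mathcal{L}^1(|u-v|>\varepsilon)\le\varepsilon\}$; it induces the concentration topology. Lipschitz order: $Y\prec X$ if there is a 1-Lipschitz $f\colon X\to Y$ with $f_*\mu_X=\mu_Y$. A pyramid is a nonempty $\square$-closed set $\mathcal{P}\subset\mathcal{X}$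 such that $X\in\mathcal{P}$, $Y\prec X$ imply $Y\in\mathcal{P}$, and any $Y,Y'\in\mathcal{P}$ have a common upper bound $X\in\mathcal{P}$ for $\prec$. $\Pi$ is the set of pyramids. Pyramids $\mathcal{P}_n$ converge weakly to $\mathcal{P}$ if $\square(X,\mathcal{P}_n)\to0$ for every $X\in\mathcal{P}$ and $\liminf_n\square(X,\mathcal{P}_n)>0$ for every $X\notin\mathcal{P}$. The weak topology on $\Pi$ is the topology of a metric $\rho$ on $\Pi$ compatible with weak convergence (e.g. $\rho(\mathcal{P},\mathcal{P}')=\sum_{k\ge1}2^{-k-2}k^{-1}d_{\mathrm{H}}(\mathcal{P}\cap\mathcal{X}(k,k),\mathcal{P}'\cap\mathcal{X}(k,k))$, with $d_{\mathrm{H}}$ the $\square$-Hausdorff distance and $\mathcal{X}(N,R)$ the set of spaces $(\mathbb{R}^N,\|\cdot\|_\infty,\mu)$ with $\operatorname{supp}\mu$ in the closed $R$-ball about $0$). *)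

(* Defs.v *)
From HB Require Import structures.
From mathcomp Require Import all_boot all_order all_algebra.
From mathcomp Require Import all_classical all_reals all_analysis.
Unset Printing Implicit Defensive.
Import Order.TTheory GRing.Theory Num.Theory.
Local Open Scope classical_set_scope.
Local Open Scope ring_scope.

Definition mball {R : realType} {T : Type} (d : T -> T -> R) (x : T) (r : R)
  : set T := [set y | d x y < r].

Definition mopen {R : realType} {T : Type} (d : T -> T -> R) (A : set T) :=
  forall x, A x -> exists2 r : R, 0 < r & mball d x r `<=` A.

Definition mborel {R : realType} {T : Type} (d : T -> T -> R) : set (set T) :=
  <<s mopen d >>.

Definition is_metric {R : realType} {T : Type} (d : T -> T -> R) :=
  [/\ forall x, d x x = 0, forall x y, d x y = 0 -> x = y,
      forall x y, d x y = d y x &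
      forall x y z, d x z <= d x y + d y z].

Definition complete_metric {R : realType} {T : Type} (d : T -> T -> R) :=
  forall u : nat -> T,
    (forall e : R, 0 < e -> exists N, forall m n, (N <= m)%N -> (N <= n)%N ->
        d (u m) (u n) < e) ->
    exists x, forall e : R, 0 < e -> exists N, forall n, (N <= n)%N -> d (u n) x < e.

Definition separable_metric {R : realType} {T : Type} (d : T -> T -> R) :=
  exists u : nat -> T, forall x (e : R), 0 < e -> exists n, d x (u n) < e.

(** Borel probability measure on (T,d) (values outside Borel sets irrelevant). *)
Definition is_borel_prob {R : realType} {T : Type} (d : T -> T -> R)
    (mu : set T -> \bar R) :=
  [/\ mu set0 = 0%E,
      forall A, mborel d A -> (0 <= mu A)%E,
      forall F : nat -> set T, (forall n, mborel d (F n)) -> trivIset setT F ->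
        (fun n => \sum_(k < n) mu (F k))%E @ \oo --> mu (\bigcup_k F k) &
      mu setT = 1%E].

Record mmstruct (R : realType) (T : Type) := MMStruct {
  mm_d : T -> T -> R ;
  mm_mu : set T -> \bar R ;
  mm_metric : is_metric mm_d ;
  mm_complete : complete_metric mm_d ;
  mm_separable : separable_metric mm_d ;
  mm_prob : is_borel_prob mm_d mm_mu }.

Record mmspace (R : realType) := MMSpace {
  mm_T : Type ;
  mm_s : mmstruct R mm_T }.

Arguments mm_d {R T}.
Arguments mm_mu {R T}.
Arguments MMSpace {R mm_T}.
Arguments mm_T {R}.
Arguments mm_s {R}.

Definition dist {R : realType} (X : mmspace R) := mm_d (mm_s X).
Definition meas {R : realType} (X : mmspace R) := mm_mu (mm_s X).

Definition supp {R : realType} (X : mmspace R) : set (mm_T X) :=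
  [set x | forall r : R, 0 < r -> (0 < meas X (mball (dist X) x r))%E].

Definition mm_iso {R : realType} (X Y : mmspace R) :=
  exists f : mm_T X -> mm_T Y,
    [/\ forall x x', supp X x -> supp X x' -> dist Y (f x) (f x') = dist X x x',
        f @` supp X = supp Y &
        forall B, mborel (dist Y) B -> meas X (supp X `&` f @^-1` B) = meas Y B].

Definition dinf {R : realType} (N : nat) (x y : 'rV[R]_N) : R :=
  \big[Num.max/0]_(i < N) `|x ord0 i - y ord0 i|.

Definition inXNR {R : realType} (N : nat) (r : R) (Y : mmspace R) :=
  exists s : mmstruct R 'rV[R]_N,
    [/\ mm_d s = @dinf R N,
        supp (MMSpace s) `<=` [set x : 'rV[R]_N | dinf N x 0 <= r] &
        mm_iso Y (MMSpace s)].

Definition I01 {R : realType} : set R := [set s | 0 <= s < 1].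

Definition Leb {R : realType} (A : set R) : \bar R :=
  @lebesgue_measure R A.

Definition Lmeasurable {R : realType} (A : set R) : Prop :=
  @measurable _ (measurableTypeR R) A.

(** phi : I -> X Borel with phi_* L^1 = mu_X (phi is only looked at on I) *)
Definition parameter {R : realType} (X : mmspace R) (phi : R -> mm_T X) :=
  forall B, mborel (dist X) B ->
    Lmeasurable (I01 `&` phi @^-1` B) /\ Leb (I01 `&` phi @^-1` B) = meas X B.

Definition box {R : realType} (X Y : mmspace R) : R :=
  inf [set e : R | 0 <= e /\
    exists (phi : R -> mm_T X) (psi : R -> mm_T Y) (I0 : set R),
      [/\ parameter X phi, parameter Y psi, Lmeasurable I0 /\ I0 `<=` I01,
          ((1 - e)%:E <= Leb I0)%E &
          forall s t, I0 s -> I0 t ->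
            `|dist X (phi s) (phi t) - dist Y (psi s) (psi t)| <= e]].

Definition dKF {R : realType} (u v : R -> R) : R :=
  inf [set e : R | 0 <= e /\
         (Leb (I01 `&` [set s | (e < `|u s - v s|)%R]) <= e%:E)%E].

Definition dHaus {R : realType} {U : Type} (d : U -> U -> R) (A B : U -> Prop) : R :=
  Num.max
    (sup [set r : R | exists a, A a /\ r = inf [set r' : R | exists b, B b /\ r' = d a b]])
    (sup [set r : R | exists b, B b /\ r = inf [set r' : R | exists a, A a /\ r' = d a b]]).

Definition Lip1 {R : realType} (X : mmspace R) : set (mm_T X -> R) :=
  [set f | forall x y, `|f x - f y| <= dist X x y].

Definition dconc {R : realType} (X Y : mmspace R) : R :=
  inf [set e : R | exists (phi : R -> mm_T X) (psi : R -> mm_T Y),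
      [/\ parameter X phi, parameter Y psi &
          e = dHaus dKF [set f \o phi | f in Lip1 X] [set g \o psi | g in Lip1 Y]]].

Definition lip_dom {R : realType} (Y X : mmspace R) :=
  exists f : mm_T X -> mm_T Y,
    (forall x x', dist Y (f x) (f x') <= dist X x x') /\
    (forall B, mborel (dist Y) B -> meas X (f @^-1` B) = meas Y B).

Definition is_pyramid {R : realType} (P : mmspace R -> Prop) :=
  [/\ exists X, P X,
      forall X, (forall e : R, 0 < e -> exists2 Y, P Y & box X Y < e) -> P X,
      forall X Y, P X -> lip_dom Y X -> P Y &
      forall Y Y', P Y -> P Y' ->
        exists X, [/\ P X, lip_dom Y X & lip_dom Y' X]].

Definition rho {R : realType} (P Q : mmspace R -> Prop) : R :=
  limn (fun n : nat => \sum_(1 <= k < n)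
     ((2%:R ^- (k + 2)%N) / k%:R *
      dHaus (@box R) (fun Y => P Y /\ inXNR k k%:R Y) (fun Y => Q Y /\ inXNR k k%:R Y))).

(** * Topological notions for a space S (a subset of U) whose points are the
    classes of the equivalence eqv, with the topology of the pseudometric d
    (d is compatible with eqv).  Maps out of the space are represented on
    representatives and required to respect eqv. *)

Definition unitI {R : realType} : set R := [set t | 0 <= t <= 1].

Definition cont_path {R : realType} {U : Type} (d : U -> U -> R) (g : R -> U) :=
  forall t, unitI t -> forall e : R, 0 < e -> exists2 del : R, 0 < del &
    forall s, unitI s -> `|s - t| < del -> d (g t) (g s) < e.

Definition cont_square {R : realType} {U : Type} (d : U -> U -> R)
    (G : R -> R -> U) :=
  forall s t, unitI s -> unitI t -> forall e : R, 0 < e -> exists2 del : R, 0 < del &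
    forall s' t', unitI s' -> unitI t' -> `|s' - s| < del -> `|t' - t| < del ->
      d (G s t) (G s' t') < e.

Definition contractible {R : realType} {U : Type} (d : U -> U -> R)
    (eqv : U -> U -> Prop) (S : U -> Prop) :=
  exists (H : U -> R -> U) (x0 : U), [/\ S x0,
    forall x t, S x -> unitI t -> S (H x t),
    forall x t, S x -> unitI t -> forall e : R, 0 < e -> exists2 del : R, 0 < del &
      forall y s, S y -> unitI s -> d x y < del -> `|s - t| < del ->
        d (H x t) (H y s) < e,
    forall x y t, S x -> S y -> unitI t -> eqv x y -> eqv (H x t) (H y t) &
    forall x, S x -> eqv (H x 0) x /\ eqv (H x 1) x0].

Definition path_connected {R : realType} {U : Type} (d : U -> U -> R)
    (eqv : U -> U -> Prop) (S : U -> Prop) :=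
  forall x y, S x -> S y -> exists g : R -> U,
    [/\ cont_path d g, forall t, unitI t -> S (g t), eqv (g 0) x & eqv (g 1) y].

Definition simply_connected {R : realType} {U : Type} (d : U -> U -> R)
    (eqv : U -> U -> Prop) (S : U -> Prop) :=
  path_connected d eqv S /\
  forall g : R -> U, cont_path d g -> (forall t, unitI t -> S (g t)) ->
    eqv (g 1) (g 0) ->
    exists G : R -> R -> U,
      [/\ cont_square d G, forall s t, unitI s -> unitI t -> S (G s t),
          forall s, unitI s -> eqv (G s 0) (g s) /\ eqv (G s 1) (g 0) &
          forall t, unitI t -> eqv (G 0 t) (g 0) /\ eqv (G 1 t) (g 0)].

(* Main.v *)
Require Import Defs.
From HB Require Import structures.
From mathcomp Require Import all_boot all_order all_algebra.
From mathcomp Require Import all_classical all_reals all_analysis.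
From mathcomp Require Import ring lra.

(** Spaces are contracted to a point by scaling the metric down: from a single
    pair of parameters one reads off that [box] and [dconc] between [a X] and
    [b Y], with [0 <= a, b <= 1], are small once [X], [Y] and [a], [b] are close,
    because all but a small part of [X] lies in a ball.  On pyramids scaling
    is not continuous (it fixes the largest pyramid), so a pyramid [P] is
    contracted instead through the subpyramids of those spaces in [P] whose
    support has diameter at most [D], with [D] decreasing from [+oo] to [0].
    Inside X(k, k) closeness is preserved: if [Y] has diameter at most [D] and is
    [box]-close to [Y'], then the recentred coordinates of [Y], carried over to
    [Y'] by McShane's extension and clamped, give a space dominated by [Y'], of
    diameter at most [D'], close to [Y].

    The infima defining [box] and [dconc] are meaningful only because every
    space has a parameter.  It is built by laying out the cells cut out by
    countably many balls as nested half-open intervals of [[0, 1)] and decoding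
    the resulting binary sequence by completeness. *)

Set Implicit Arguments.
Unset Strict Implicit.
Unset Printing Implicit Defensive.
Import Order.TTheory GRing.Theory Num.Theory.
Import numFieldNormedType.Exports.
Local Open Scope classical_set_scope.
Local Open Scope ring_scope.

(** * Sigma-algebras and Lebesgue measure on the unit interval *)

(** For spaces, continuity rests on splitting (1 - t) a - (1 - s) b into (s - t) a and (1 - s) (a -
    b), where a and b are corresponding distances. The coupling controls the second term. The first
    needs a radius outside which [X] has little mass; it must depend on [X] alone, because it fixes
    the modulus before any parameters are given.

    For pyramids, the tail of the weak metric is uniformly small, so finitely many k matter and the
    modulus may depend on k. A diameter bound has to become a bound on coordinates. In the sup norm
    this is exact: each coordinate is recentred separately, and radius is half of diameter (a
    Euclidean norm would bring in Jung's constant). The bound (1 - t) / t on the diameter blows up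
    at t = 0, but inside X(k, k) the radius saturates at k and is Lipschitz in t.

    Paths and loops are made of representatives, and a loop closes only up to equivalence. Tracks
    can still be concatenated because each contraction ends exactly at the base point, while its
    start agrees with the given point only up to equivalence. The track of the base point of a loop
    need not be constant, so it has to be retracted at the end. *)

Section sigma_algebra_closure.
Variables (T : Type) (M : set (set T)).
Hypothesis sM : sigma_algebra setT M.

Lemma salg_set0 : M set0. Proof. by case: sM. Qed.

Lemma salgC A : M A -> M (~` A).
Proof. by case: sM => _ h _ /h; rewrite setTD. Qed.

Lemma salgT : M setT. Proof. by rewrite -setC0; apply/salgC/salg_set0. Qed.

Lemma salg_bigcup (F : nat -> set T) : (forall n, M (F n)) -> M (\bigcup_n F n).
Proof. by case: sM => _ _; apply. Qed.

Lemma salgU A B : M A -> M B -> M (A `|` B).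
Proof.
move=> mA mB; rewrite -bigcup2E; apply: salg_bigcup => -[|[|n]] //=.
exact: salg_set0.
Qed.

Lemma salgI A B : M A -> M B -> M (A `&` B).
Proof.
by move=> mA mB; rewrite -[A `&` B]setCK setCI; apply/salgC/salgU; apply: salgC.
Qed.

Lemma salgD A B : M A -> M B -> M (A `\` B).
Proof. by move=> mA mB; rewrite setDE; apply/salgI => //; apply: salgC. Qed.

Lemma salg_cup (I : countType) (P : set I) (F : I -> set T) :
  (forall i, P i -> M (F i)) -> M (\bigcup_(i in P) F i).
Proof.
move=> mF; pose G n := if @unpickle I n is Some i
  then (if `[< P i >] then F i else set0) else set0.
have -> : \bigcup_(i in P) F i = \bigcup_n G n.
  apply/seteqP; split => x.
    by move=> [i Pi Fi]; exists (pickle i) => //; rewrite /G pickleK asboolT.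
  move=> [n _]; rewrite /G; case: unpickle => // i.
  by case: asboolP => // Pi Fi; exists i.
apply: salg_bigcup => n; rewrite /G; case: unpickle => [i|]; last exact: salg_set0.
by case: asboolP => [/mF//|_]; exact: salg_set0.
Qed.

Lemma salg_cap (I : countType) (P : set I) (F : I -> set T) :
  (forall i, P i -> M (F i)) -> M (\bigcap_(i in P) F i).
Proof.
move=> mF; rewrite -[X in M X]setCK setC_bigcap; apply: salgC.
by apply: salg_cup => i Pi; apply/salgC/mF.
Qed.

(** Good-sets principle. The domain [D] is kept because an mm-isomorphism is controlled on the
    support only. *)
Lemma salg_preimage (U : Type) (G : set (set U)) (D : set T) (f : T -> U) :
  M D -> (forall A, G A -> M (D `&` f @^-1` A)) ->
  forall B, <<s G >> B -> M (D `&` f @^-1` B).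
Proof.
move=> mD mG; apply: (@smallest_sub _ _ _ [set B | M (D `&` f @^-1` B)]) => //.
split => /=.
- by rewrite preimage_set0 setI0; exact: salg_set0.
- move=> A mA; rewrite setTD.
  have -> : D `&` f @^-1` (~` A) = D `\` (D `&` f @^-1` A).
    apply/seteqP; split => x /= [Dx h]; split=> //; first by case.
    by move=> Af; apply: h.
  exact: salgD.
- move=> A mA; rewrite preimage_bigcup setI_bigcupr; exact: salg_bigcup.
Qed.

End sigma_algebra_closure.

Lemma sigma_algebra_Lmeasurable (R : realType) : sigma_algebra setT (@Lmeasurable R).
Proof. exact: (@sigma_algebra_measurable _ (measurableTypeR R)). Qed.

Lemma sigma_algebra_mborel (R : realType) (T : Type) (d : T -> T -> R) :
  sigma_algebra setT (mborel d).
Proof. exact: smallest_sigma_algebra. Qed.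

Section Leb.
Variable R : realType.
Implicit Types A B : set R.

(** [lebesgue_measure] is an outer measure on all subsets of the line, so monotonicity and
    subadditivity apply directly to the superlevel sets in [dKF]. *)
Lemma Leb_le A B : A `<=` B -> (Leb A <= Leb B)%E.
Proof. by move=> AB; rewrite /Leb; apply: le_outer_measure. Qed.

Lemma Leb_setU_le A B : (Leb (A `|` B) <= Leb A + Leb B)%E.
Proof. exact: outer_measureU2. Qed.

Lemma Leb_ge0 A : (0 <= Leb A)%E.
Proof. exact: measure_ge0. Qed.

Lemma Leb_set0 : Leb (set0 : set R) = 0%E.
Proof. exact: measure0. Qed.

Lemma I01_itv : (I01 : set R) = `[0, 1[%classic.
Proof. by apply/seteqP; split => x /=; rewrite in_itv. Qed.

Lemma Lmeasurable_I01 : Lmeasurable (@I01 R).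
Proof. by rewrite I01_itv; exact: measurable_itv. Qed.

Lemma Leb_I01 : Leb (@I01 R) = 1%E.
Proof.
by rewrite I01_itv /Leb lebesgue_measure_itv /= lte_fin ltr01 oppr0 adde0.
Qed.

Lemma Leb_co (a m : R) : 0 <= m -> Leb [set s : R | a <= s < a + m] = m%:E.
Proof.
move=> m0; have -> : [set s : R | a <= s < a + m] = `[a, a + m[%classic.
  by apply/seteqP; split => x /=; rewrite in_itv.
rewrite /Leb lebesgue_measure_itv /= lte_fin.
case: ifPn => [_|]; first by rewrite -EFinB addrC addKr.
by rewrite -leNgt => am; congr (_%:E); lra.
Qed.

Lemma Lmeasurable_co (a b : R) : Lmeasurable [set s : R | a <= s < b].
Proof.
have -> : [set s : R | a <= s < b] = `[a, b[%classic.
  by apply/seteqP; split => x /=; rewrite in_itv.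
exact: measurable_itv.
Qed.

Lemma Leb_setU A B : Lmeasurable A -> Lmeasurable B -> A `&` B = set0 ->
  Leb (A `|` B) = (Leb A + Leb B)%E.
Proof. exact: measureU. Qed.

Lemma Leb_bigcup_cvg (F : nat -> set R) : (forall n, Lmeasurable (F n)) ->
  trivIset setT F ->
  (fun n => \sum_(k < n) Leb (F k))%E @ \oo --> Leb (\bigcup_k F k).
Proof.
move=> mF tF; have := @measure_sigma_additive _ _ _ (@lebesgue_measure R) F mF tF.
by under eq_fun do rewrite big_mkord.
Qed.

Lemma Leb_cup0 (I : countType) (P : set I) (F : I -> set R) :
  (forall i, P i -> Leb (F i) = 0%E) -> Leb (\bigcup_(i in P) F i) = 0%E.
Proof.
move=> F0; pose G n := if @unpickle I n is Some i
  then (if `[< P i >] then F i else set0) else set0.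
have G0 n : Leb (G n) = 0%E.
  rewrite /G; case: unpickle => [i|]; last exact: Leb_set0.
  by case: asboolP => [/F0|_ ]//; exact: Leb_set0.
apply/eqP; rewrite eq_le Leb_ge0 andbT.
have sub : \bigcup_(i in P) F i `<=` \bigcup_n G n.
  by move=> x [i Pi Fi]; exists (pickle i) => //; rewrite /G pickleK asboolT.
apply: (le_trans (Leb_le sub)).
apply: (le_trans (outer_measure_sigma_subadditive _ _)).
by rewrite eseries0// => n _ _; exact: G0.
Qed.

Lemma Leb_I01_fin A : A `<=` I01 -> Leb A \is a fin_num.
Proof.
move=> AI; rewrite ge0_fin_numE ?Leb_ge0 //.
by apply: (le_lt_trans (Leb_le AI)); rewrite Leb_I01 ltry.
Qed.

Lemma Leb_I01D A : Lmeasurable A -> A `<=` I01 ->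
  (Leb (I01 `\` A) = 1 - Leb A)%E.
Proof.
move=> mA AI; have mD : Lmeasurable (I01 `\` A).
  by apply: (salgD (sigma_algebra_Lmeasurable R)) => //; exact: Lmeasurable_I01.
have d0 : A `&` (I01 `\` A) = set0 by apply/seteqP; split => // x [? []].
have := Leb_setU mA mD d0; rewrite setDUK // Leb_I01 => ->.
by rewrite (addeC (Leb A)) addeK // Leb_I01_fin.
Qed.

End Leb.

Section borel_probability.
Variables (R : realType) (T : Type) (d : T -> T -> R) (mu : set T -> \bar R).
Hypothesis pmu : is_borel_prob d mu.

Lemma bprob_ge0 A : mborel d A -> (0 <= mu A)%E.
Proof. by case: pmu => _ + _ _; apply. Qed.

Lemma bprobU A B : mborel d A -> mborel d B -> A `&` B = set0 ->
  mu (A `|` B) = (mu A + mu B)%E.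
Proof.
move=> mA mB AB0; have [mu0 _ sadd _] := pmu.
have mF n : mborel d (bigcup2 A B n).
  by case: n => [|[|n]] //=; exact: (salg_set0 (sigma_algebra_mborel d)).
have := sadd _ mF; rewrite bigcup2E -trivIset_bigcup2 => /(_ AB0) cv.
apply: (cvg_unique (@ereal_hausdorff R) cv).
apply: cvg_near_cst; exists 2%N => // n /= n2.
rewrite -(subnKC n2) big_split_ord /= !big_ord_recl big_ord0 /= adde0.
rewrite big1 ?adde0 // => i _; by rewrite mu0.
Qed.

Lemma bprobC A : mborel d A -> (mu (~` A) = 1 - mu A)%E.
Proof.
move=> mA; have [_ _ _ muT] := pmu.
have mC : mborel d (~` A) by apply: (salgC (sigma_algebra_mborel d)).
have := bprobU mA mC (setICr A); rewrite setUCr muT => E.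
have fA : mu A \is a fin_num.
  rewrite ge0_fin_numE ?bprob_ge0 //; rewrite ltey; apply/eqP => Ay.
  by move: E; rewrite Ay addye // gt_eqF // (lt_le_trans ltNy0) // bprob_ge0.
by rewrite E (addeC (mu A)) addeK.
Qed.

Lemma bprob_fin A : mborel d A -> mu A \is a fin_num.
Proof.
move=> mA; have := bprobC mA; have : (0 <= mu (~` A))%E.
  by apply: bprob_ge0; apply: (salgC (sigma_algebra_mborel d)).
have := bprob_ge0 mA.
by case: (mu A) => [r| |] //= _ + E; rewrite E.
Qed.

End borel_probability.

(** * Existence of parameters *)

(** The newest bit comes first: lengthening a prefix is a [cons], shortening it a [drop]. *)
Fixpoint prefix_word (n : nat) (w : nat -> bool) : seq bool :=
  if n is m.+1 then w m :: prefix_word m w else [::].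

Lemma size_prefix_word n w : size (prefix_word n w) = n.
Proof. by elim: n => //= n ->. Qed.

Lemma drop_prefix_word k n w :
  drop k (prefix_word (k + n) w) = prefix_word n w.
Proof. by elim: k => [|k IH] /=; [rewrite drop0|]. Qed.

Definition cylinder (w : seq bool) : set (nat -> bool) :=
  [set om | prefix_word (size w) om = w].

(** Two cylinders are nested or disjoint, so adding the empty set makes a pi-system. *)
Definition cylinders : set (set (nat -> bool)) :=
  [set A | A = set0 \/ exists w, A = cylinder w].

Lemma cylinder_setI w w' : (size w <= size w')%N ->
  cylinders (cylinder w `&` cylinder w').
Proof.
move=> ww'; have [dw|dw] := eqVneq (drop (size w' - size w) w') w.
  right; exists w'; apply/seteqP; split => [om []//|om wom]; split => //.
  rewrite /cylinder /=; rewrite -(@drop_prefix_word (size w' - size w)).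
  by rewrite subnK // wom.
left; apply/seteqP; split => // om [] /=; rewrite /cylinder /= => E E'.
by case/eqP: dw; rewrite -{2}E -(@drop_prefix_word (size w' - size w)) subnK // E'.
Qed.

Lemma cylinders_setI_closed : setI_closed cylinders.
Proof.
move=> A B [->|[w ->]]; first by left; rewrite set0I.
move=> [->|[w' ->]]; first by left; rewrite setI0.
have [|/ltnW] := leqP (size w) (size w'); first exact: cylinder_setI.
by rewrite setIC; exact: cylinder_setI.
Qed.

Lemma bit_cylinders n : <<s cylinders >> [set om | om n].
Proof.
rewrite [X in <<s _ >> X](_ : _ =
    \bigcup_(w in [set w : seq bool | size w = n.+1 /\ head false w]) cylinder w).
  apply: (salg_cup (smallest_sigma_algebra setT cylinders)) => w _.
  by apply: sub_sigma_algebra; right; exists w.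
apply/seteqP; split => [om /= omn|om [w [sw hw]]].
  exists (prefix_word n.+1 om); rewrite /cylinder /= ?size_prefix_word //.
by rewrite /cylinder /= sw /= => E; move: hw; rewrite -E.
Qed.

(** * Transport of a Borel probability to the unit interval by binary words *)

Section bit_transport.
Variables (R : realType) (T : Type) (d : T -> T -> R) (mu : set T -> \bar R).
Hypothesis pmu : is_borel_prob d mu.
Variable b : nat -> set T.
Hypothesis mb : forall n, mborel d (b n).

Definition bits_of (x : T) : nat -> bool := fun n => `[< b n x >].

Lemma bits_of_borel E : <<s cylinders >> E -> mborel d (bits_of @^-1` E).
Proof.
move=> mE; rewrite -[X in mborel d X]setTI.
apply: (salg_preimage (sigma_algebra_mborel d)) mE; first exact: (salgT (sigma_algebra_mborel d)).
move=> A; rewrite setTI => -[->|[w ->]].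
  by rewrite preimage_set0; exact: (salg_set0 (sigma_algebra_mborel d)).
elim: w => [|c w IH].
  rewrite (_ : _ @^-1` _ = setT); first exact: (salgT (sigma_algebra_mborel d)).
  by apply/seteqP; split.
have -> : bits_of @^-1` cylinder (c :: w) =
    bits_of @^-1` cylinder w `&` (if c then b (size w) else ~` b (size w)).
  apply/seteqP; split => x; rewrite /cylinder /bits_of /=.
    by move=> [<- h]; split => //; case: asboolP.
  by case: c => -[h bx]; [rewrite asboolT ?h|rewrite asboolF ?h].
apply: (salgI (sigma_algebra_mborel d)) => //; case: c => //.
exact: (salgC (sigma_algebra_mborel d)).
Qed.

Definition cell_mass (w : seq bool) : R := fine (mu (bits_of @^-1` cylinder w)).

Lemma cylinder_borel w : mborel d (bits_of @^-1` cylinder w).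
Proof. by apply: bits_of_borel; apply: sub_sigma_algebra; right; exists w. Qed.

Lemma cell_massE w : (cell_mass w)%:E = mu (bits_of @^-1` cylinder w).
Proof. by rewrite fineK //; apply: (bprob_fin pmu); exact: cylinder_borel. Qed.

Lemma cell_mass_ge0 w : 0 <= cell_mass w.
Proof. by rewrite -lee_fin cell_massE; apply: (bprob_ge0 pmu); exact: cylinder_borel. Qed.

Lemma cell_mass_nil : cell_mass [::] = 1.
Proof.
have [_ _ _ muT] := pmu; rewrite /cell_mass (_ : _ @^-1` _ = setT) ?muT //.
by apply/seteqP; split.
Qed.

Lemma cell_mass_cons w : cell_mass w = cell_mass (false :: w) + cell_mass (true :: w).
Proof.
apply: EFin_inj; rewrite EFinD !cell_massE -(bprobU pmu); try exact: cylinder_borel.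
  congr mu; apply/seteqP; split => x; rewrite /cylinder /=.
    by move=> ->; case: (bits_of x (size w)); [right|left].
  by move=> [[_ ->]|[_ ->]].
apply/seteqP; split => // x; rewrite /cylinder /=.
by move=> [[-> _]] [].
Qed.

Fixpoint cell_left (w : seq bool) : R :=
  if w is c :: v then (if c then cell_left v + cell_mass (false :: v) else cell_left v)
  else 0.

(* The binary word of [s]: the cells of each generation are laid out from left
   to right as half-open intervals of length equal to their mass. *)
Fixpoint unit_word (n : nat) (s : R) : seq bool :=
  if n is m.+1 then
    (cell_left (unit_word m s) + cell_mass (false :: unit_word m s) <= s)
      :: unit_word m s
  else [::].

Lemma unit_wordP (w : seq bool) (s : R) : I01 s ->
  unit_word (size w) s = w <-> cell_left w <= s < cell_left w + cell_mass w.
Proof.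
move=> s01; elim: w => [|c w IH] /=.
  by split => // _; rewrite cell_mass_nil add0r.
have h0 := cell_mass_ge0 (false :: w); have h1 := cell_mass_ge0 (true :: w).
have hw := cell_mass_cons w.
split.
  move=> [E1 E2]; move: E1; rewrite E2; move/IH: E2 => /andP[E2 E3].
  by case: c => [E1|/negbT]; rewrite -?ltNge; [lra|move=> E1; lra].
case: c => h.
  have /IH -> : cell_left w <= s < cell_left w + cell_mass w by lra.
  by congr (_ :: _); case/andP: h.
have /IH -> : cell_left w <= s < cell_left w + cell_mass w by lra.
by congr (_ :: _); apply/negbTE; rewrite -ltNge; lra.
Qed.

Definition unit_bits (s : R) (n : nat) : bool := head false (unit_word n.+1 s).

Lemma prefix_unit_bits n s : prefix_word n (unit_bits s) = unit_word n s.
Proof. by elim: n => //= n ->. Qed.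

(** On a cylinder the equality says that the length of an interval is the mass of its cell.
    Cylinders form a pi-system, and Dynkin's theorem extends the equality. *)
Lemma unit_bits_law E : <<s cylinders >> E ->
  Lmeasurable (I01 `&` unit_bits @^-1` E) /\
  Leb (I01 `&` unit_bits @^-1` E) = mu (bits_of @^-1` E).
Proof.
(* Measurability of both preimages is carried along, since the complement and union steps use it. *)
move=> mE; pose good E := [/\ Lmeasurable (I01 `&` unit_bits @^-1` E),
  mborel d (bits_of @^-1` E) &
  Leb (I01 `&` unit_bits @^-1` E) = mu (bits_of @^-1` E)].
suff : <<s cylinders >> `<=` good by move=> /(_ _ mE) [].
have [mu0 _ musadd muT] := pmu.
rewrite -(setI_closed_g_dynkin_g_sigma_algebra cylinders_setI_closed).
apply: smallest_sub; first split.
- rewrite /good !preimage_setT setIT; split; first exact: Lmeasurable_I01.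
    exact: (salgT (sigma_algebra_mborel d)).
  by rewrite Leb_I01 muT.
- move=> A [mA mA' e]; rewrite /good preimage_setC.
  have -> : I01 `&` unit_bits @^-1` (~` A) = I01 `\` (I01 `&` unit_bits @^-1` A).
    apply/seteqP; split => x /= [Dx h]; split=> //; first by case.
    by move=> Af; apply: h.
  split.
  + apply: (salgD (sigma_algebra_Lmeasurable R)) => //; exact: Lmeasurable_I01.
  + exact: (salgC (sigma_algebra_mborel d)).
  + by rewrite (bprobC pmu) // -e Leb_I01D // => x [].
- move=> F tF gF; rewrite /good !preimage_bigcup setI_bigcupr.
  have m1 n : Lmeasurable (I01 `&` unit_bits @^-1` F n) by case: (gF n).
  have m2 n : mborel d (bits_of @^-1` F n) by case: (gF n).
  split.
  + exact: (salg_bigcup (sigma_algebra_Lmeasurable R)).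
  + exact: (salg_bigcup (sigma_algebra_mborel d)).
  + have t1 : trivIset setT (fun n => I01 `&` unit_bits @^-1` F n).
      apply/trivIsetP => i j _ _ ij; apply/seteqP; split => // x /= [[_ xi] [_ xj]].
      by move/trivIsetP: tF => /(_ i j I I ij) /seteqP[+ _]; apply; split; [exact: xi|].
    have t2 : trivIset setT (fun n => bits_of @^-1` F n).
      apply/trivIsetP => i j _ _ ij; apply/seteqP; split => // x /= [xi xj].
      by move/trivIsetP: tF => /(_ i j I I ij) /seteqP[+ _]; apply; split; [exact: xi|].
    have c2 := musadd _ m2 t2.
    have := Leb_bigcup_cvg m1 t1.
    under eq_fun do (under eq_bigr do rewrite (let: And3 _ _ e := gF _ in e)).
    by move=> c1; exact: (cvg_unique (@ereal_hausdorff R) c1 c2).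
- move=> A [->|[w ->]].
    rewrite /good !preimage_set0 setI0 Leb_set0 mu0; split => //.
      exact: (salg_set0 (sigma_algebra_Lmeasurable R)).
    exact: (salg_set0 (sigma_algebra_mborel d)).
  have E1 : I01 `&` unit_bits @^-1` cylinder w =
      I01 `&` [set s | cell_left w <= s < cell_left w + cell_mass w].
    apply/seteqP; split => s [s01 /=]; rewrite /cylinder /= prefix_unit_bits;
    by move=> /(unit_wordP w s01) h; split.
  (* Children lie inside the interval of their parent, so every cell stays inside the root interval
     [I01]. *)
  have sub : [set s | cell_left w <= s < cell_left w + cell_mass w] `<=` I01.
    elim: w {E1} => [|c w IH] /= s.
      by rewrite cell_mass_nil add0r.
    have h0 := cell_mass_ge0 (false :: w); have h1 := cell_mass_ge0 (true :: w).
    have hw := cell_mass_cons w.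
    by move=> h; apply: IH => /=; case: c h => /= h; lra.
  rewrite /good E1; split; [|exact: cylinder_borel|].
    apply: (salgI (sigma_algebra_Lmeasurable R)); first exact: Lmeasurable_I01.
    exact: Lmeasurable_co.
  by rewrite setIidr // Leb_co ?cell_mass_ge0 // cell_massE.
Qed.

End bit_transport.

Section metric_basics.
Variables (R : realType) (T : Type) (d : T -> T -> R).
Hypothesis md : is_metric d.

Lemma metric_ge0 x y : 0 <= d x y.
Proof.
have [d0 _ dC dT] := md; have := dT x y x; rewrite d0 (dC y x); lra.
Qed.

Lemma mopen_mball x r : mopen d (mball d x r).
Proof.
have [_ _ _ dT] := md; move=> y; rewrite /mball /= => xy.
exists (r - d x y); first lra.
by move=> z /= yz; have := dT x y z; lra.
Qed.

Lemma mborel_mball x r : mborel d (mball d x r).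
Proof. by apply: sub_sigma_algebra; exact: mopen_mball. Qed.

Lemma mborel_open A : mopen d A -> mborel d A.
Proof. by move=> oA; exact: sub_sigma_algebra. Qed.

End metric_basics.

Lemma invS_lt (R : realType) (e : R) : 0 < e ->
  exists N, forall n, (N <= n)%N -> n.+1%:R^-1 < e.
Proof.
move=> e0; have [N _ hN] := near_infty_natSinv_lt (PosNum e0).
by exists N => n /hN.
Qed.

(** * Decoding binary sequences into points by completeness *)

Section decoding.
Variables (R : realType) (T : Type) (d : T -> T -> R).
Hypothesis md : is_metric d.
Hypothesis cd : complete_metric d.
Variable u : nat -> T.
Hypothesis du : forall x (e : R), 0 < e -> exists n, d x (u n) < e.

Let r (n : nat) : R := n.+1%:R^-1.

Let r_gt0 n : 0 < r n. Proof. by rewrite /r invr_gt0. Qed.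

Definition near_center (m : nat) : set T :=
  if @unpickle (nat * nat)%type m is Some ni then mball d (u ni.2) (r ni.1) else set0.

Lemma near_center_borel m : mborel d (near_center m).
Proof.
rewrite /near_center; case: unpickle => [ni|]; first exact: mborel_mball.
exact: (salg_set0 (sigma_algebra_mborel d)).
Qed.

Let ev (n i : nat) : set (nat -> bool) := [set om | om (pickle (n, i))].

(** Necessary conditions on the bits of a point, balls sharing a point having close centres; they
    suffice for decoding, and form a measurable set because they involve countably many bits. *)
Definition coherent : set (nat -> bool) :=
  [set om | (forall n, exists i, ev n i om) /\
    forall n i n' i', ev n i om -> ev n' i' om -> d (u i) (u i') <= r n + r n'].

(** One marked centre per scale gives a Cauchy sequence. Comparing it with an arbitrary marked
    centre and passing to the limit gives the bound for all marked centres. *)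
Lemma coherent_limit om : coherent om ->
  exists y, forall n i, ev n i om -> d (u i) y <= r n.
Proof.
have [_ _ dC dT] := md; move=> [/choice[f hf] h2].
have [|y hy] := cd (u := u \o f).
  move=> e e0; have [|N hN] := @invS_lt R (e / 2); first lra.
  exists N => m n Nm Nn /=; have := h2 _ _ _ _ (hf m) (hf n).
  have hm : r m < e / 2 := hN _ Nm; have hn : r n < e / 2 := hN _ Nn; lra.
exists y => n i evi; apply/ler_addgt0Pr => e e0.
have [|N hN] := @invS_lt R (e / 2); first lra.
have [|M hM] := hy (e / 2); first lra.
have := dT (u i) (u (f (maxn N M))) y.
have := h2 _ _ _ _ evi (hf (maxn N M)).
have := hM _ (leq_maxr N M); have : r (maxn N M) < e / 2 := hN _ (leq_maxl N M).
by rewrite /=; lra.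
Qed.

Lemma coherent_measurable : <<s cylinders >> coherent.
Proof.
have sC := smallest_sigma_algebra setT cylinders.
rewrite (_ : coherent = (\bigcap_n \bigcup_i ev n i) `&`
  \bigcap_(q in [set q : (nat * nat) * (nat * nat) |
      ~ d (u q.1.2) (u q.2.2) <= r q.1.1 + r q.2.1])
    ~` (ev q.1.1 q.1.2 `&` ev q.2.1 q.2.2)).
  apply: (salgI sC); apply: (salg_cap sC).
    move=> n _; apply: (salg_cup sC) => i _; exact: (bit_cylinders (pickle (_, _))).
  move=> q _; apply: (salgC sC); apply: (salgI sC); exact: (bit_cylinders (pickle (_, _))).
apply/seteqP; split => om.
  move=> [h1 h2]; split; first by move=> n _; have [i hi] := h1 n; exists i.
  by move=> q /= nq [e1 e2]; apply: nq; apply: h2.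
move=> [h1 h2]; split; first by move=> n; have [i _ hi] := h1 n I; exists i.
move=> n i n' i' e1 e2; apply: contrapT => nq.
by apply: (h2 ((n, i), (n', i')) nq).
Qed.

(** A measurable left inverse of the coding. Its value lies in an open set exactly when some marked
    ball is contained in that set, which is a countable condition on the bits. *)
Lemma decoder : exists g : (nat -> bool) -> T,
  (forall x, g (bits_of near_center x) = x) /\
  forall B, mborel d B -> <<s cylinders >> (g @^-1` B).
Proof.
have sC := smallest_sigma_algebra setT cylinders.
have [_ d0 dC dT] := md.
have /choice[g hg] : forall om, exists y : T,
    (coherent om -> forall n i, ev n i om -> d (u i) y <= r n) /\
    (~ coherent om -> y = u 0%N).
  move=> om; have [/[dup]/coherent_limit[y hy] c|c] := pselect (coherent om).
    by exists y.
  by exists (u 0%N).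
have evE x n i : ev n i (bits_of near_center x) = (d (u i) x < r n) :> Prop.
  by rewrite /ev /= /bits_of /near_center pickleK /mball /= asboolb.
exists g; split.
  move=> x; have cx : coherent (bits_of near_center x).
    split=> [n|n i n' i']; first by have [i] := du x (r_gt0 n); rewrite dC; exists i; rewrite evE.
    by rewrite !evE => h1 h2; have := dT (u i) x (u i'); rewrite (dC x); lra.
  apply/esym/d0/eqP; rewrite eq_le metric_ge0 // andbT.
  apply/ler_addgt0Pr => e e0; rewrite add0r.
  have [|N hN] := @invS_lt R (e / 2); first lra.
  have [i] := du x (r_gt0 N); rewrite dC => hi.
  have evi : ev N i (bits_of near_center x) by rewrite evE.
  have := (hg _).1 cx N i evi; have := dT x (u i) (g (bits_of near_center x)).
  have hr : r N < e / 2 := hN _ (leqnn N).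
  by move: hi; rewrite (dC x (u i)); lra.
move=> B mB; rewrite -[X in <<s _ >> X]setTI.
apply: (salg_preimage sC (salgT sC)) mB => {}B oB; rewrite setTI.
(* Closed balls, since [g om] is within [r n] of a marked centre but not strictly. Incoherent
   sequences all go to [u 0], whence the last term. *)
rewrite (_ : g @^-1` B = (coherent `&` \bigcup_(q in [set q : nat * nat |
    [set y | d (u q.2) y <= r q.1] `<=` B]) ev q.1 q.2) `|`
   (if `[< B (u 0%N) >] then ~` coherent else set0)).
  apply: (salgU sC).
    apply: (salgI sC); first exact: coherent_measurable.
    by apply: (salg_cup sC) => q _; exact: (bit_cylinders (pickle (_, _))).
  case: asboolP => _; last exact: (salg_set0 sC).
  by apply: (salgC sC); exact: coherent_measurable.
apply/seteqP; split => om /=.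
  move=> Bg; have [c|c] := pselect (coherent om); last first.
    by right; rewrite asboolT //; rewrite -((hg om).2 c).
  left; split => //; have [e e0 eB] := oB _ Bg.
  have [|N hN] := @invS_lt R (e / 2); first lra.
  have [i evi] := c.1 N; exists (N, i) => //= y hy; apply: eB; rewrite /mball /=.
  have := (hg _).1 c N i evi; have := dT (g om) (u i) y; rewrite (dC _ (u i)).
  have hr : r N < e / 2 := hN _ (leqnn N).
  by move: hy; rewrite /=; lra.
move=> [[c [[n i] /= sub evi]]|].
  by apply: sub => /=; exact: (hg om).1.
by case: asboolP => // Bu c; rewrite ((hg om).2 c).
Qed.

End decoding.

(** [unit_bits] has the law of the coding of a [mu]-distributed point, and [g] undoes the coding. *)
Lemma parameter_exists (R : realType) (X : mmspace R) : exists phi, parameter X phi.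
Proof.
case: X => T [d mu md cd [u du] pmu].
have [g [gK mg]] := decoder md cd du.
exists (g \o unit_bits mu (near_center d u)) => B mB.
have mb := near_center_borel md u.
have [h1 h2] := unit_bits_law pmu mb (mg _ mB).
split => //; rewrite h2 /=; congr mu.
by apply/seteqP; split => x /=; rewrite gK.
Qed.

(** * Consequences of a contraction *)

Definition clamp01 {R : realType} (x : R) : R := Num.max 0 (Num.min 1 x).

Variant clamp01_spec {R : realType} (x : R) : R -> Prop :=
| Clamp01Low of x <= 0 : clamp01_spec x 0
| Clamp01Mid of 0 <= x <= 1 : clamp01_spec x x
| Clamp01High of 1 <= x : clamp01_spec x 1.

Lemma clamp01P {R : realType} (x : R) : clamp01_spec x (clamp01 x).
Proof.
rewrite /clamp01; have [x1|x1] := leP 1 x.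
  by rewrite max_r //; constructor.
have [x0'|x0'] := leP 0 x; first by constructor; rewrite x0' ltW.
by constructor; exact: ltW.
Qed.

Variant min_spec {R : realType} (x y : R) : R -> Prop :=
| MinLeft of x <= y : min_spec x y x
| MinRight of y <= x : min_spec x y y.

Lemma minP {R : realType} (x y : R) : min_spec x y (Num.min x y).
Proof. by case: (leP x y) => [?|/ltW ?]; constructor. Qed.

Section contractible_consequences.
Variables (R : realType) (U : Type) (d : U -> U -> R).
Variables (eqv : U -> U -> Prop) (S : U -> Prop) (H : U -> R -> U) (x0 : U).
Hypothesis HS : forall x t, S x -> unitI t -> S (H x t).
Hypothesis Hcont : forall x t, S x -> unitI t -> forall e : R, 0 < e ->
  exists2 del : R, 0 < del &
      forall y s, S y -> unitI s -> d x y < del -> `|s - t| < del ->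
        d (H x t) (H y s) < e.
Hypothesis H0 : forall x, S x -> eqv (H x 0) x.
Hypothesis H1 : forall x, S x -> H x 1 = x0.
Hypothesis dxx : forall x, S x -> d x x = 0.
Hypothesis d_eqv : forall x y, S x -> S y -> eqv x y -> d x y = 0.
Hypothesis eqv_trans : forall x y z, eqv x y -> eqv y z -> eqv x z.

Lemma unitI0 : unitI (0 : R). Proof. by rewrite /unitI /= lexx ler01. Qed.
Lemma unitI1 : unitI (1 : R). Proof. by rewrite /unitI /= lexx ler01. Qed.

(** Climb along the track of [x] and descend along that of [y]. The tracks meet because [H x 1 = x0]
    is an equality, not an equivalence. *)
Lemma contraction_path_connected : path_connected d eqv S.
Proof.
move=> x y Sx Sy.
pose g t := if t <= 2^-1 then H x (2 * t) else H y (2 - 2 * t).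
exists g; split.
- move=> t; rewrite /unitI /= => ht e e0; rewrite /g.
  have [le|gt] := leP t 2^-1; last first.
    have u' : unitI (2 - 2 * t) by rewrite /unitI /=; lra.
    have [del del0 hd] := Hcont Sy u' e0.
    exists (Num.min (del / 2) (t - 2^-1)); first by rewrite lt_min; apply/andP; split; lra.
    move=> s hs; rewrite lt_min !ltr_norml => hst.
    have [|_] := leP s 2^-1; first lra.
    apply: hd => //; rewrite ?dxx // ?ltr_norml; try lra.
    by rewrite /unitI /=; lra.
  have u' : unitI (2 * t) by rewrite /unitI /=; lra.
  have [del del0 hd] := Hcont Sx u' e0.
  have [del2 del20 hd2] := Hcont Sy unitI1 e0.
  have [tlt|tge] := ltP t 2^-1.
    exists (Num.min (del / 2) (2^-1 - t)); first by rewrite lt_min; apply/andP; split; lra.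
    move=> s hs; rewrite lt_min !ltr_norml => hst.
    have [_|] := leP s 2^-1; last lra.
    apply: hd => //; rewrite ?dxx // ?ltr_norml; try lra.
    by rewrite /unitI /=; lra.
  exists (Num.min (del / 2) (del2 / 2)); first by rewrite lt_min; apply/andP; split; lra.
  move=> s hs; rewrite lt_min !ltr_norml => hst.
  have [sl|sg] := leP s 2^-1.
    apply: hd => //; rewrite ?dxx // ?ltr_norml; try lra.
    by rewrite /unitI /=; lra.
  have -> : 2 * t = 1 by lra.
  rewrite H1 // -(H1 Sy); apply: hd2 => //; rewrite ?dxx // ?ltr_norml; try lra.
  by rewrite /unitI /=; lra.
- by move=> t ht; rewrite /g; case: leP => h; apply: HS => //; move: ht; rewrite /unitI /=; lra.
- by rewrite /g ifT ?mulr0 ?invr_ge0 //; exact: H0.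
- by rewrite /g ifF ?mulr1 ?subrr //; [exact: H0|apply/negbTE; rewrite -ltNge; lra].
Qed.

Let clamp01_unit (x : R) : unitI (clamp01 x).
Proof. by rewrite /unitI /=; case: clamp01P; lra. Qed.

Let clamp01_lip (x y : R) : `|clamp01 x - clamp01 y| <= `|x - y|.
Proof.
rewrite ler_norml; have h1 := ler_norm (x - y); have := ler_norm (- (x - y)).
by rewrite normrN => h2; case: clamp01P; case: clamp01P; lra.
Qed.

(** Rescale time to total length 1 + 4t: climb along the track of [g 0] for time 2t, run the loop at
    height 2t for time 1, descend for time 2t. [sg] is the loop parameter and [up] the height; at t
    = 1/2 the height coincides with [up2]. *)
Let sg (s t : R) := clamp01 ((1 + 4 * t) * s - 2 * t).
Let up (s t : R) :=
  clamp01 (Num.min (2 * t) (Num.min ((1 + 4 * t) * s) ((1 + 4 * t) * (1 - s)))).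
Let up2 (s t : R) := clamp01 (Num.min (2 - 2 * t) (Num.min (3 * s) (3 * (1 - s)))).

Let min_lip (x y x' y' e : R) : `|x - x'| <= e -> `|y - y'| <= e ->
  `|Num.min x y - Num.min x' y'| <= e.
Proof.
rewrite !ler_norml.
by case: minP; case: minP; lra.
Qed.

(** The worst case is [sg]: its terms s, 4ts and 2t vary by at most [del], [8 * del] and
    [2 * del]. *)
Let lip4 (s t s' t' del : R) : unitI s -> unitI t -> unitI s' -> unitI t' ->
  `|s' - s| < del -> `|t' - t| < del ->
  [/\ `|sg s' t' - sg s t| <= 11 * del,
      `|up s' t' - up s t| <= 11 * del & `|up2 s' t' - up2 s t| <= 11 * del].
Proof.
rewrite /unitI /= => hs ht hs' ht'; rewrite !ltr_norml => h1 h2.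
have k : `|t' * s' - t * s| <= 2 * del.
  have -> : t' * s' - t * s = (t' - t) * s' + t * (s' - s) by ring.
  apply: (le_trans (ler_normD _ _)); rewrite !normrM.
  have a1 : `|t' - t| <= del by rewrite ler_norml; lra.
  have a2 : `|s' - s| <= del by rewrite ler_norml; lra.
  rewrite (ger0_norm (_ : 0 <= s')) ?(ger0_norm (_ : 0 <= t)); try lra.
  have := normr_ge0 (t' - t); have := normr_ge0 (s' - s); nra.
move: k; rewrite ler_norml => k.
split; apply: (le_trans (clamp01_lip _ _)).
- by rewrite ler_norml; nra.
- by do 2?[apply: min_lip]; rewrite ler_norml; nra.
- by do 2?[apply: min_lip]; rewrite ler_norml; nra.
Qed.

Lemma contraction_simply_connected : simply_connected d eqv S.
Proof.
split; first exact: contraction_path_connected.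
move=> g cg Sg g10.
have S0 : S (g 0) by apply: Sg; exact: unitI0.
have S1 : S (g 1) by apply: Sg; exact: unitI1.
(* First slide the loop up to the cone point, dragging its base point along
   the track of [g 0]; then retract the resulting path back along that track. *)
pose G s t := if t <= 2^-1 then H (g (sg s t)) (up s t)
  else if s < 2^-1 then H (g 0) (up2 s t) else H (g 1) (up2 s t).
have c1 s t : unitI s -> unitI t -> forall e : R, 0 < e -> exists2 del : R, 0 < del &
    forall s' t', unitI s' -> unitI t' -> `|s' - s| < del -> `|t' - t| < del ->
      d (H (g (sg s t)) (up s t)) (H (g (sg s' t')) (up s' t')) < e.
  move=> hs ht e e0.
  have [d1 d10 h1] := Hcont (Sg _ (clamp01_unit _)) (clamp01_unit _) e0
    : exists2 del : R, 0 < del & forall y s0, S y -> unitI s0 ->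
       d (g (sg s t)) y < del -> `|s0 - up s t| < del -> d (H (g (sg s t)) (up s t)) (H y s0) < e.
  have [d2 d20 h2] := cg _ (clamp01_unit ((1 + 4 * t) * s - 2 * t)) _ d10.
  exists (Num.min d1 d2 / 12); first by rewrite divr_gt0 // lt_min d10.
  move=> s' t' hs' ht' ss tt; have [l1 l2 _] := lip4 hs ht hs' ht' ss tt.
  have m1 : Num.min d1 d2 <= d1 by rewrite ge_min lexx.
  have m2 : Num.min d1 d2 <= d2 by rewrite ge_min lexx orbT.
  have m0 : 0 < Num.min d1 d2 by rewrite lt_min d10.
  apply: h1; [exact/Sg/clamp01_unit|exact: clamp01_unit| |].
    by apply: h2; [exact: clamp01_unit|apply: (le_lt_trans l1); lra].
  by apply: (le_lt_trans l2); lra.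
(* Two representatives at distance zero are allowed, for the junction s = 1/2 where the base
   switches between [g 0] and [g 1]. *)
have c2 x y s t : S x -> S y -> d x y = 0 -> unitI s -> unitI t ->
    forall e : R, 0 < e -> exists2 del : R, 0 < del &
    forall s' t', unitI s' -> unitI t' -> `|s' - s| < del -> `|t' - t| < del ->
      d (H x (up2 s t)) (H y (up2 s' t')) < e.
  move=> Sx Sy dxy hs ht e e0.
  have [d1 d10 h1] := Hcont Sx (clamp01_unit _) e0
    : exists2 del : R, 0 < del & forall y s0, S y -> unitI s0 ->
       d x y < del -> `|s0 - up2 s t| < del -> d (H x (up2 s t)) (H y s0) < e.
  exists (d1 / 12); first lra.
  move=> s' t' hs' ht' ss tt; have [_ _ l2] := lip4 hs ht hs' ht' ss tt.
  apply: h1; [by []|exact: clamp01_unit|by rewrite dxy|].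
  by apply: (le_lt_trans l2); lra.
have d01 := dxx S0; have d11 := dxx S1.
have d10 : d (g 1) (g 0) = 0 by exact: d_eqv.
(* The two formulas for [G] agree at t = 1/2: either the loop parameter is at an end of the loop, or
   the height is 1 and every track is at [x0]. *)
have half s t : unitI s -> t = 2^-1 ->
    [/\ up s t = up2 s t, (s <= 2^-1 -> H (g (sg s t)) (up s t) = H (g 0) (up2 s t)) &
        (2^-1 <= s -> H (g (sg s t)) (up s t) = H (g 1) (up2 s t))].
  rewrite /unitI /= => hs ->.
  have -> : up s 2^-1 = up2 s 2^-1.
    rewrite /up /up2; congr (clamp01 (Num.min _ (Num.min _ _))); lra.
  split => // hs2.
    have [s3|s3] := leP (3 * s) 1.
      congr (H (g _) _); rewrite /sg; case: clamp01P; lra.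
    have -> : up2 s 2^-1 = 1.
      rewrite /up2; case: minP; case: minP; case: clamp01P; lra.
    by rewrite !H1 //; exact/Sg/clamp01_unit.
  have [s3|s3] := leP (3 * (1 - s)) 1.
    congr (H (g _) _); rewrite /sg; case: clamp01P; lra.
  have -> : up2 s 2^-1 = 1.
    rewrite /up2; case: minP; case: minP; case: clamp01P; lra.
  by rewrite !H1 //; exact/Sg/clamp01_unit.
exists G; split.
- move=> s t hs ht e e0.
  have [d1 d1p h1] := c1 s t hs ht e e0.
  have [d2 d2p h2] := c2 (g 0) (g 0) s t S0 S0 d01 hs ht e e0.
  have [d3 d3p h3] := c2 (g 1) (g 1) s t S1 S1 d11 hs ht e e0.
  have [d4 d4p h4] := c2 (g 1) (g 0) s t S1 S0 d10 hs ht e e0.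
  (* Distance to a dividing line, so that nearby points stay on the same side of it; on the line
     itself the value 1 is a positive placeholder. *)
  pose gap (x : R) := if x == 0 then 1 else `|x|.
  have gap_gt0 x : 0 < gap x by rewrite /gap; case: eqP => // /eqP; rewrite normr_gt0.
  have gapP x y : `|y - x| < gap (x - 2^-1) -> x != 2^-1 ->
      (y <= 2^-1) = (x <= 2^-1) /\ (y < 2^-1) = (x < 2^-1).
    rewrite /gap subr_eq0 => + xn; rewrite (negbTE xn).
    have := ltr_norml (y - x) `|x - 2^-1|.
    have [xl|xg|xe] := ltgtP x 2^-1; last by rewrite xe eqxx in xn.
      rewrite ltr0_norm ?subr_lt0 // => -> h; split; [apply/idP|apply/idP]; lra.
    rewrite gtr0_norm ?subr_gt0 // => -> h.
    by split; apply/negbTE; rewrite -?leNgt -?ltNge; lra.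
  exists (Num.min (Num.min (Num.min d1 d2) (Num.min d3 d4))
     (Num.min (gap (t - 2^-1)) (gap (s - 2^-1)))).
    by rewrite !lt_min d1p d2p d3p d4p !gap_gt0.
  move=> s' t' hs' ht'; rewrite !lt_min.
  move=> /andP[/andP[/andP[s1 s2] /andP[s3 s4]] /andP[_ sgap]].
  move=> /andP[/andP[/andP[t1 t2] /andP[t3 t4]] /andP[tgap _]].
  rewrite /G; have [te|tn] := eqVneq t 2^-1.
    rewrite {1}te lexx; have [_ k1 k2] := half s t hs te.
    case: ifPn => _; first exact: h1.
    case: ifPn => ss'.
      have [sl|sg'] := leP s 2^-1; first by rewrite k1 //; exact: h2.
      have [_] := gapP s s' sgap (negbT (gt_eqF sg')).
      by rewrite ss' ltNge (ltW sg').
    rewrite -leNgt in ss'; have [sl|sg'] := leP 2^-1 s; first by rewrite k2 //; exact: h3.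
    have [_] := gapP s s' sgap (negbT (lt_eqF sg')).
    by rewrite sg' ltNge ss'.
  have [-> _] := gapP t t' tgap tn; case: ifPn => _; first exact: h1.
  have [se|sn] := eqVneq s 2^-1.
    by rewrite {1}se ltxx; case: ifPn => _; [exact: h4|exact: h3].
  have [_ ->] := gapP s s' sgap sn; case: ifPn => _; [exact: h2|exact: h3].
- move=> s t hs ht; rewrite /G; case: ifPn => _.
    by apply: HS; [exact/Sg/clamp01_unit|exact: clamp01_unit].
  by case: ifPn => _; apply: HS => //; exact: clamp01_unit.
- move=> s hs; split.
    rewrite /G ifT ?invr_ge0 //; move: (hs); rewrite /unitI /= => hs'.
    have -> : sg s 0 = s by rewrite /sg; case: clamp01P; lra.
    have -> : up s 0 = 0.
      by rewrite /up; case: minP; case: minP; case: clamp01P; lra.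
    exact/H0/Sg.
  rewrite /G ifF; last by apply/negbTE; rewrite -ltNge; lra.
  move: hs; rewrite /unitI /= => hs.
  have -> : up2 s 1 = 0.
    by rewrite /up2; case: minP; case: minP; case: clamp01P; lra.
  by case: ifPn => _; [exact: H0|exact: (eqv_trans (H0 S1))].
- move=> t ht; split.
    have -> : G 0 t = H (g 0) 0; last exact: H0.
    move: ht; rewrite /unitI /= => ht; rewrite /G; case: ifPn => th.
      congr (H (g _) _).
        by rewrite /sg; case: clamp01P; lra.
      rewrite /up mulr0 subr0 mulr1.
      by case: minP; case: minP; case: clamp01P; lra.
    rewrite ifT ?invr_gt0 //; congr H.
    by rewrite /up2; case: minP; case: minP; case: clamp01P; lra.
  have -> : G 1 t = H (g 1) 0; last exact: (eqv_trans (H0 S1)).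
  move: ht; rewrite /unitI /= => ht; rewrite /G; case: ifPn => th.
    congr (H (g _) _).
      by rewrite /sg; case: clamp01P; lra.
    rewrite /up subrr mulr0 mulr1.
    by case: minP; case: minP; case: clamp01P; lra.
  rewrite ifF; last by apply/negbTE; rewrite -leNgt; lra.
  congr H.
  by rewrite /up2; case: minP; case: minP; case: clamp01P; lra.
Qed.

Lemma contraction_all : S x0 -> eqv x0 x0 ->
  (forall x y t, S x -> S y -> unitI t -> eqv x y -> eqv (H x t) (H y t)) ->
  contractible d eqv S /\ path_connected d eqv S /\ simply_connected d eqv S.
Proof.
move=> Sx0 e0 He; split; last first.
  split; [exact: contraction_path_connected|exact: contraction_simply_connected].
by exists H, x0; split => // x Sx; split; [exact: H0|rewrite H1].
Qed.

End contractible_consequences.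

(** * Supports and isomorphisms of mm-spaces *)

Arguments mm_metric {R T}.
Arguments mm_complete {R T}.
Arguments mm_separable {R T}.
Arguments mm_prob {R T}.

Section mm_basics.
Variables (R : realType) (X : mmspace R).

Lemma dist_metric : is_metric (dist X). Proof. exact: mm_metric. Qed.

Lemma dist_ge0 x y : 0 <= dist X x y.
Proof. exact: (metric_ge0 dist_metric). Qed.

Lemma dist_xx x : dist X x x = 0. Proof. by have [] := dist_metric. Qed.

Lemma dist_sym x y : dist X x y = dist X y x.
Proof. by have [_ _ dC _] := dist_metric. Qed.

Lemma dist_triangle y x z : dist X x z <= dist X x y + dist X y z.
Proof. by have [_ _ _ dT] := dist_metric. Qed.

Lemma meas_set0 : meas X set0 = 0%E. Proof. by case: (mm_prob (mm_s X)). Qed.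

Lemma meas_setT : meas X setT = 1%E. Proof. by case: (mm_prob (mm_s X)). Qed.

(** Inherited from Lebesgue measure through a parameter. *)
Lemma meas_le A B : mborel (dist X) A -> mborel (dist X) B -> A `<=` B ->
  (meas X A <= meas X B)%E.
Proof.
have [phi pphi] := parameter_exists X; move=> mA mB AB.
have [_ <-] := pphi _ mA; have [_ <-] := pphi _ mB.
by apply: Leb_le => s [? ?]; split => //; exact: AB.
Qed.

Lemma supp_closed : mopen (dist X) (~` supp X).
Proof.
move=> x; rewrite /supp /= => /existsNP[r /not_implyP[r0 nr]].
exists (r / 2); first lra.
move=> y xy /= /(_ (r / 2)) h; apply: nr.
have r2 : 0 < r / 2 by lra.
apply: (lt_le_trans (h r2)); apply: meas_le.
- exact: (mborel_mball dist_metric).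
- exact: (mborel_mball dist_metric).
- by move=> z; rewrite /mball /= => yz; have := dist_triangle y x z; move: xy; rewrite /mball /=; lra.
Qed.

Lemma mborel_supp : mborel (dist X) (supp X).
Proof.
rewrite -[X in mborel _ X]setCK; apply: (salgC (sigma_algebra_mborel _)).
by apply: mborel_open; exact: supp_closed.
Qed.

(** By separability, countably many null balls cover the complement of the support. *)
Lemma param_suppC phi : parameter X phi -> Leb (I01 `&` phi @^-1` (~` supp X)) = 0%E.
Proof.
move=> pphi; have [u hu] := mm_separable (mm_s X).
apply/eqP; rewrite eq_le Leb_ge0 andbT.
pose Q := [set q : nat * nat | meas X (mball (dist X) (u q.2) q.1.+1%:R^-1) = 0%E].
have <- : Leb (\bigcup_(q in Q) (I01 `&` phi @^-1` (mball (dist X) (u q.2) q.1.+1%:R^-1)))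
    = 0%E.
  apply: Leb_cup0 => q Qq.
  by have [_ ->] := pphi _ (mborel_mball dist_metric (u q.2) q.1.+1%:R^-1).
apply: Leb_le => s [s01] /=; rewrite /supp /= => /existsNP[r /not_implyP[r0 nr]].
have [|N /(_ N (leqnn _)) hN] := @invS_lt R (r / 2); first lra.
have rN : 0 < N.+1%:R^-1 :> R by rewrite invr_gt0.
have [i hi] := hu (phi s) _ rN.
exists (N, i); last by split => //; rewrite /mball /= dist_sym.
rewrite /Q /=; apply/eqP; rewrite eq_le; apply/andP; split; last first.
  by apply: (bprob_ge0 (mm_prob (mm_s X))); exact: (mborel_mball dist_metric).
move/negP: nr; rewrite -leNgt; apply: le_trans; apply: meas_le.
- exact: (mborel_mball dist_metric).
- exact: (mborel_mball dist_metric).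
- move=> z; rewrite /mball /= => uz; have := dist_triangle (u i) (phi s) z.
  by move: hi hN uz; rewrite -/(dist X); set k := _^-1; lra.
Qed.

Lemma meas_suppI B : mborel (dist X) B -> meas X (supp X `&` B) = meas X B.
Proof.
have [phi pphi] := parameter_exists X; move=> mB.
have mS := salgI (sigma_algebra_mborel _) mborel_supp mB.
have [_ <-] := pphi _ mS; have [_ <-] := pphi _ mB.
apply/eqP; rewrite eq_le; apply/andP; split.
  by apply: Leb_le => s [? []].
rewrite -[leRHS]adde0 -(param_suppC pphi).
apply: le_trans (Leb_setU_le _ _); apply: Leb_le => s [s01 Bs].
by have [|] := pselect (supp X (phi s)); [left|right].
Qed.

Lemma supp_meets B : mborel (dist X) B -> (0 < meas X B)%E ->
  exists2 x, supp X x & B x.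
Proof.
move=> mB; rewrite -meas_suppI //; have [] := eqVneq (supp X `&` B) set0.
  by move=> ->; rewrite meas_set0 ltxx.
by move=> /set0P[x [? ?]] _; exists x.
Qed.

Lemma supp_nonempty : exists x, supp X x.
Proof.
have [||x sx _] := @supp_meets setT; last by exists x.
  exact: (salgT (sigma_algebra_mborel _)).
by rewrite meas_setT lte_fin ltr01.
Qed.

Lemma param_comp_measurable (phi : R -> mm_T X) B : parameter X phi ->
  mborel (dist X) B -> Lmeasurable (I01 `&` phi @^-1` B).
Proof. by move=> pphi mB; have [] := pphi _ mB. Qed.

(** Continuity from above along complements of balls. [D] serves all parameters at once, since the
    measure of the preimage depends on [X] only; it can be fixed before a coupling is chosen. *)
Lemma mm_tight (x : mm_T X) (e : R) : 0 < e -> exists D : R, 0 < D /\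
  forall phi, parameter X phi ->
    (Leb (I01 `&` phi @^-1` [set y | (D <= dist X x y)%R]) <= e%:E)%E.
Proof.
move=> e0; have [phi pphi] := parameter_exists X.
have mF (D : R) : mborel (dist X) [set y | (D <= dist X x y)%R].
  rewrite (_ : [set y | _] = ~` mball (dist X) x D); last first.
    by apply/seteqP; split => y; rewrite /mball /= leNgt => /negP.
  by apply: (salgC (sigma_algebra_mborel _)); exact: (mborel_mball dist_metric).
pose F (n : nat) := I01 `&` phi @^-1` [set y | (n.+1%:R <= dist X x y)%R].
have m1 n : Lmeasurable (F n) by exact: param_comp_measurable.
have E0 : \bigcap_n F n = set0.
  apply/seteqP; split => // s h; have [n _ hn] := nbhs_infty_gtr (dist X x (phi s)).
  have [_ /=] := h n I; have := hn n.+1 (leqnSn n); rewrite /=; lra.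
have : (Leb \o F) @ \oo --> (0%E : \bar R).
  rewrite -[X in _ --> X](@Leb_set0 R) -E0.
  apply: (@nonincreasing_cvg_mu _ _ _ (@lebesgue_measure R) F) => //.
  - suff : (Leb (F 0%N) < +oo)%E by [].
    apply: (@le_lt_trans _ _ (Leb (@I01 R))); last by rewrite Leb_I01 ltry.
    by apply: Leb_le => s [].
  - by apply: (salg_cap (sigma_algebra_Lmeasurable R)) => n _; exact: m1.
  - move=> n m nm; apply/subsetPset => s [s01 /= h]; split => //=.
    by apply: le_trans h; rewrite ler_nat ltnS.
move=> /fine_cvgP[_] /cvgrPdist_lt /(_ _ e0) [N _ /(_ N (leqnn _))] /=.
rewrite sub0r normrN => h; exists N.+1%:R; split; first by [].
move=> psi ppsi; have [_ ->] := ppsi _ (mF N.+1%:R); have [_ <-] := pphi _ (mF N.+1%:R).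
rewrite -/(F N) -[leLHS]fineK ?lee_fin.
  by apply: ltW; apply: le_lt_trans h; exact: ler_norm.
by apply: Leb_I01_fin => s [].
Qed.

End mm_basics.

Section mm_isomorphism.
Variable R : realType.
Implicit Types X Y Z : mmspace R.

(** Off the support [f] is arbitrary, so the claim concerns the trace on the support. There the
    preimage of an open set is relatively open, cut out by the union [O] of balls about support
    points. *)
Lemma mborel_isometry_preimage X Y (f : mm_T X -> mm_T Y) :
  (forall x x', supp X x -> supp X x' -> dist Y (f x) (f x') = dist X x x') ->
  forall B, mborel (dist Y) B -> mborel (dist X) (supp X `&` f @^-1` B).
Proof.
move=> fiso; apply: (salg_preimage (sigma_algebra_mborel _)).
  exact: mborel_supp.
move=> A oA.
pose O := [set y | exists x r, [/\ supp X x, 0 < r, mball (dist Y) (f x) r `<=` A &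
  dist X x y < r]].
have -> : supp X `&` f @^-1` A = supp X `&` O.
  apply/seteqP; split => y [sy /=].
    by move=> /oA[r r0 rA]; split => //; exists y, r; split => //; rewrite dist_xx.
  by move=> [x [r [sx r0 rA xy]]]; split => //=; apply: rA; rewrite /mball /= fiso.
apply: (salgI (sigma_algebra_mborel _)); first exact: mborel_supp.
apply: mborel_open => y [x [r [sx r0 rA xy]]].
exists (r - dist X x y); first lra.
move=> z; rewrite /mball /= => yz; exists x, r; split => //.
by have := dist_triangle (X := X) y x z; lra.
Qed.

Lemma mm_iso_refl X : mm_iso X X.
Proof.
exists id; split => //; first by rewrite image_id.
by move=> B mB; rewrite preimage_id meas_suppI.
Qed.

Lemma mm_iso_trans X Y Z : mm_iso X Y -> mm_iso Y Z -> mm_iso X Z.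
Proof.
move=> [f [fiso fS fm]] [g [giso gS gm]].
have fsupp x : supp X x -> supp Y (f x) by rewrite -fS => sx; exists x.
exists (g \o f); split.
- by move=> x x' sx sx' /=; rewrite giso ?fiso //; exact: fsupp.
- by rewrite -image_comp fS.
- move=> B mB; rewrite -gm // -fm; last exact: mborel_isometry_preimage.
  congr (meas X _); apply/seteqP; split => x /= [sx]; last by case.
  by move=> Bx; split => //; split => //; exact: fsupp.
Qed.

Lemma mm_iso_coupling X Y : mm_iso X Y -> exists phi psi I0,
  [/\ parameter X phi, parameter Y psi, Lmeasurable I0 /\ I0 `<=` I01,
      Leb I0 = 1%E &
      forall s t, I0 s -> I0 t -> dist X (phi s) (phi t) = dist Y (psi s) (psi t)].
Proof.
move=> [f [fiso fS fm]]; have [phi pphi] := parameter_exists X.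
have [x0 sx0] := supp_nonempty X.
(* Off the support [f] is uncontrolled; moving this null set to a single support point makes
   [f \o phi'] a parameter. *)
pose phi' s := if `[< supp X (phi s) >] then phi s else x0.
have mS : mborel (dist X) (supp X) by exact: mborel_supp.
have [mI0 LI0] := pphi _ mS.
exists phi, (f \o phi'), (I01 `&` phi @^-1` supp X); split => //.
- move=> B mB; have mfB := mborel_isometry_preimage fiso mB.
  have [mE LE] := pphi _ mfB.
  have mN : Lmeasurable (I01 `&` phi @^-1` (~` supp X)).
    by apply: param_comp_measurable => //; apply: (salgC (sigma_algebra_mborel _)).
  have EE : I01 `&` (f \o phi') @^-1` B = (I01 `&` phi @^-1` (supp X `&` f @^-1` B)) `|`
      (if `[< B (f x0) >] then I01 `&` phi @^-1` (~` supp X) else set0).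
    apply/seteqP; split => s.
      move=> [s01]; rewrite /phi' /=; case: asboolP => sp Bs; first by left.
      by right; rewrite asboolT.
    move=> [[s01 /= [sp Bs]]|]; first by split => //=; rewrite /phi' asboolT.
    by case: asboolP => // Bx [s01 /= sp]; split => //=; rewrite /phi' asboolF.
  split; rewrite EE.
    apply: (salgU (sigma_algebra_Lmeasurable R)) => //.
    by case: ifP => // _; exact: (salg_set0 (sigma_algebra_Lmeasurable R)).
  apply/eqP; rewrite eq_le; apply/andP; split.
    apply: (le_trans (Leb_setU_le _ _)); rewrite LE fm //.
    by case: ifP; rewrite ?param_suppC // ?Leb_set0 adde0.
  by rewrite -(fm _ mB) -LE; apply: Leb_le; left.
- by rewrite LI0 -[supp X]setIT meas_suppI ?meas_setT //; exact: (salgT (sigma_algebra_mborel _)).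
- by move=> s t [_ /= ss] [_ /= st]; rewrite /phi' !asboolT // fiso.
Qed.

End mm_isomorphism.

(** * The box and observable distances *)

Section inf_sup_distances.
Variables (R : realType) (U : Type) (d : U -> U -> R).
Hypothesis d01 : forall a b, 0 <= d a b <= 1.
Implicit Types A B : U -> Prop.

Let d0 a b : 0 <= d a b. Proof. by case/andP: (d01 a b). Qed.

Let lbd0 (I : Type) (B : I -> Prop) (f : I -> R) : (forall i, 0 <= f i) ->
  lbound [set r' : R | exists b, B b /\ r' = f b] 0.
Proof. by move=> f0 r [b [_ ->]]. Qed.

Let inf_bd (B : U -> Prop) (f : U -> R) : (forall i, 0 <= f i <= 1) ->
  0 <= inf [set r' : R | exists b, B b /\ r' = f b] <= 1.
Proof.
move=> f01; have f0 b : 0 <= f b by case/andP: (f01 b).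
have [[b Bb]|nB] := pselect (exists b, B b).
  have ne : [set r' : R | exists b, B b /\ r' = f b] !=set0 by exists (f b), b.
  rewrite lb_le_inf //; last exact: lbd0.
  apply: (@le_trans _ _ (f b)); last by case/andP: (f01 b).
  by apply: ge_inf; [exists 0; exact: lbd0|exists b].
rewrite (_ : [set r' | _] = set0) ?inf0 ?lexx ?ler01 //.
by apply/seteqP; split => // r [b [Bb _]]; apply: nB; exists b.
Qed.

Let sup_bd (A : U -> Prop) (f : U -> R) : (forall i, 0 <= f i <= 1) ->
  0 <= sup [set r : R | exists a, A a /\ r = f a] <= 1.
Proof.
move=> f01; have [[a Aa]|nA] := pselect (exists a, A a); last first.
  rewrite (_ : [set r | _] = set0) ?sup0 ?lexx ?ler01 //.
  by apply/seteqP; split => // r [b [Ab _]]; apply: nA; exists b.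
have ub : ubound [set r : R | exists a, A a /\ r = f a] 1.
  by move=> r [b [_ ->]]; case/andP: (f01 b).
apply/andP; split; last by apply: ge_sup => //; exists (f a), a.
apply: (@le_trans _ _ (f a)); first by case/andP: (f01 a).
by apply: ub_le_sup; [exists 1|exists a].
Qed.

Lemma dHaus_itv A B : 0 <= dHaus d A B <= 1.
Proof.
rewrite /dHaus le_max ge_max.
have /andP[-> ->] := sup_bd A (fun a => inf_bd B (d01 a)).
by have /andP[_ ->] := sup_bd B (fun b => inf_bd A (d01^~ b)).
Qed.

Let inf_le (B : U -> Prop) (f : U -> R) e : (forall i, 0 <= f i) ->
  (exists b, B b /\ f b <= e) -> inf [set r' : R | exists b, B b /\ r' = f b] <= e.
Proof.
move=> f0 [b [Bb be]]; apply: le_trans be.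
by apply: ge_inf; [exists 0; exact: lbd0|exists b].
Qed.

Lemma dHaus_le A B e : 0 <= e -> (forall a, A a -> exists b, B b /\ d a b <= e) ->
  (forall b, B b -> exists a, A a /\ d a b <= e) -> dHaus d A B <= e.
Proof.
move=> e0 hA hB; rewrite /dHaus ge_max; apply/andP; split.
  set E := [set r | _]; have [->|/set0P ne] := eqVneq E set0; first by rewrite sup0.
  by apply: ge_sup => // r [a [Aa ->]]; apply: inf_le => //; exact: hA.
set E := [set r | _]; have [->|/set0P ne] := eqVneq E set0; first by rewrite sup0.
by apply: ge_sup => // r [a [Aa ->]]; apply: inf_le => //; exact: hB.
Qed.

(** Nonemptiness of [B] matters: an infimum over the empty set is 0 by convention and yields no near
    point. The bound on [d] makes the supremum a true upper bound. *)
Lemma dHaus_lt_l A B e a : (exists b, B b) -> dHaus d A B < e -> A a ->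
  exists2 b, B b & d a b < e.
Proof.
move=> [b0 Bb0]; rewrite /dHaus gt_max => /andP[h _] Aa.
have : inf [set r' : R | exists b, B b /\ r' = d a b] < e.
  apply: le_lt_trans h; apply: ub_le_sup; last by exists a.
  by exists 1 => r [c [_ ->]]; case/andP: (inf_bd B (d01 c)).
move=> /inf_lt[|r [b [Bb ->]] lt]; last by exists b.
by exists (d a b0), b0.
Qed.

Lemma dHaus_lt_r A B e b : (exists a, A a) -> dHaus d A B < e -> B b ->
  exists2 a, A a & d a b < e.
Proof.
move=> [a0 Aa0]; rewrite /dHaus gt_max => /andP[_ h] Bb.
have : inf [set r' : R | exists a, A a /\ r' = d a b] < e.
  apply: le_lt_trans h; apply: ub_le_sup; last by exists b.
  by exists 1 => r [c [_ ->]]; case/andP: (inf_bd A (d01^~ c)).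
move=> /inf_lt[|r [a [Aa ->]] lt]; last by exists a.
by exists (d a0 b), a0.
Qed.

End inf_sup_distances.

Section box_distance.
Variable R : realType.
Implicit Types X Y : mmspace R.

Definition box_coupling X Y (e : R) (phi : R -> mm_T X) (psi : R -> mm_T Y)
    (I0 : set R) :=
  [/\ parameter X phi, parameter Y psi, Lmeasurable I0 /\ I0 `<=` I01,
      ((1 - e)%:E <= Leb I0)%E &
      forall s t, I0 s -> I0 t ->
        `|dist X (phi s) (phi t) - dist Y (psi s) (psi t)| <= e].

Lemma box_le X Y e phi psi I0 : 0 <= e -> @box_coupling X Y e phi psi I0 ->
  box X Y <= e.
Proof.
move=> e0 c; apply: ge_inf; first by exists 0 => r [].
by split => //; exists phi, psi, I0.
Qed.

(** The value 1 is always admissible, so the infimum in [box] is over a nonempty set. *)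
Lemma box_coupling1 X Y phi psi : parameter X phi -> parameter Y psi ->
  @box_coupling X Y 1 phi psi set0.
Proof.
move=> p1 p2; split => //; last by rewrite subrr Leb_set0.
by split => //; exact: (salg_set0 (sigma_algebra_Lmeasurable R)).
Qed.

Lemma box_lt X Y del : box X Y < del -> exists e phi psi I0,
  [/\ 0 <= e, e < del & @box_coupling X Y e phi psi I0].
Proof.
have [phi p1] := parameter_exists X; have [psi p2] := parameter_exists Y.
move=> /inf_lt[|e [e0 [phi' [psi' [I0 c]]]] ed]; last by exists e, phi', psi', I0.
by exists 1; split => //; exists phi, psi, set0; exact: box_coupling1.
Qed.

Lemma box_itv X Y : 0 <= box X Y <= 1.
Proof.
have [phi p1] := parameter_exists X; have [psi p2] := parameter_exists Y.
rewrite (box_le ler01 (box_coupling1 p1 p2)) andbT.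
apply: lb_le_inf; last by move=> r [].
by exists 1; split => //; exists phi, psi, set0; exact: box_coupling1.
Qed.

Lemma box_couplingC X Y e phi psi I0 : @box_coupling X Y e phi psi I0 ->
  @box_coupling Y X e psi phi I0.
Proof.
by move=> [p1 p2 mI lI h]; split => // s t Is It; rewrite distrC; exact: h.
Qed.

Lemma box_sym X Y : box X Y = box Y X.
Proof.
congr inf; apply/seteqP; split => e [e0 [phi [psi [I0 c]]]]; split => //;
by exists psi, phi, I0; exact: box_couplingC.
Qed.

Lemma box_iso X Y : mm_iso X Y -> box X Y = 0.
Proof.
move=> /mm_iso_coupling[phi [psi [I0 [p1 p2 mI lI h]]]].
apply/eqP; rewrite eq_le; case/andP: (box_itv X Y) => -> _; rewrite andbT.
apply: (@box_le _ _ _ phi psi I0) => //; split => //; first by rewrite subr0 lI.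
by move=> s t Is It; rewrite h // subrr normr0.
Qed.

End box_distance.

Section Ky_Fan.
Variable R : realType.
Implicit Types u v : R -> R.

Lemma dKF_le u v (e : R) : 0 <= e ->
  (Leb (I01 `&` [set s | (e < `|u s - v s|)%R]) <= e%:E)%E -> dKF u v <= e.
Proof. by move=> e0 h; apply: ge_inf; [exists 0 => r []|split]. Qed.

Let dKF1 u v : (Leb (I01 `&` [set s | (1 < `|u s - v s|)%R]) <= 1%:E)%E.
Proof. by rewrite -(@Leb_I01 R); apply: Leb_le => s []. Qed.

Lemma dKF_itv u v : 0 <= dKF u v <= 1.
Proof.
rewrite dKF_le // andbT; apply: lb_le_inf; last by move=> r [].
by exists 1; split.
Qed.

Lemma dKF_lt u v (del : R) : dKF u v < del ->
  (Leb (I01 `&` [set s | (del < `|u s - v s|)%R]) <= del%:E)%E.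
Proof.
move=> /inf_lt[|e [e0 he] ed]; first by exists 1; split.
apply: (@le_trans _ _ e%:E); last by rewrite lee_fin ltW.
apply: le_trans he; apply: Leb_le => s [s01 /= h]; split => //=; exact: lt_trans h.
Qed.

End Ky_Fan.

(* McShane's extension [x |-> inf_j (v j + d (p j) x)], with an additive error. *)
Lemma approx_Lip1_extension (R : realType) (X : mmspace R) (J : Type)
    (p : J -> mm_T X) (v : J -> R) (del : R) :
  (forall i j, `|v i - v j| <= dist X (p i) (p j) + del) ->
  exists2 g, Lip1 X g & forall i, `|g (p i) - v i| <= del.
Proof.
move=> hv; have [[i0 _]|nJ] := pselect (exists i : J, True); last first.
  exists (fun=> 0); last by move=> i; case: nJ; exists i.
  by move=> x y; rewrite subrr normr0 dist_ge0.
have tri i j y : v i - dist X (p i) y - del <= v j + dist X (p j) y.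
  have := hv i j; rewrite ler_norml => h.
  by have := dist_triangle (X := X) y (p i) (p j); rewrite (dist_sym y (p j)); lra.
pose E y := [set r | exists j, r = v j + dist X (p j) y].
have Ene y : E y !=set0 by exists (v i0 + dist X (p i0) y), i0.
have Elb y : has_lbound (E y).
  by exists (v i0 - dist X (p i0) y - del) => r [j ->].
have Ele y j : inf (E y) <= v j + dist X (p j) y by apply: ge_inf => //; exists j.
have half x y : inf (E x) <= inf (E y) + dist X x y.
  rewrite -lerBlDr; apply: lb_le_inf => // r [j ->].
  have := Ele x j; have := dist_triangle (X := X) y (p j) x.
  by rewrite (dist_sym y x); lra.
exists (fun y => inf (E y)).
  move=> x y; rewrite ler_norml; have := half x y; have := half y x.
  by rewrite (dist_sym y x); lra.
move=> i; have h1 := Ele (p i) i; rewrite dist_xx addr0 in h1.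
have h2 : v i - del <= inf (E (p i)).
  by apply: lb_le_inf => // r [j ->]; have := tri i j (p i); rewrite dist_xx subr0.
have d0 := le_trans (normr_ge0 _) (hv i i); rewrite dist_xx add0r in d0.
rewrite ler_norml; lra.
Qed.

Section observable_distance.
Variable R : realType.
Implicit Types X Y : mmspace R.

Definition obs X Y (phi : R -> mm_T X) (psi : R -> mm_T Y) : R :=
  dHaus dKF [set f \o phi | f in Lip1 X] [set g \o psi | g in Lip1 Y].

Lemma obs_itv X Y phi psi : 0 <= @obs X Y phi psi <= 1.
Proof. exact: (dHaus_itv (@dKF_itv R)). Qed.

Lemma Lip1_nonempty X (phi : R -> mm_T X) :
  exists u, [set f \o phi | f in Lip1 X] u.
Proof.
exists ((fun=> 0) \o phi), (fun=> 0) => //.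
by move=> x y; rewrite subrr normr0 dist_ge0.
Qed.

Lemma dconc_le X Y phi psi : parameter X phi -> parameter Y psi ->
  dconc X Y <= @obs X Y phi psi.
Proof.
move=> p1 p2; apply: ge_inf; last by exists phi, psi.
by exists 0 => r [a [b [_ _ ->]]]; case/andP: (obs_itv a b).
Qed.

Lemma dconc_lt X Y del : dconc X Y < del -> exists phi psi,
  [/\ parameter X phi, parameter Y psi & @obs X Y phi psi < del].
Proof.
have [phi p1] := parameter_exists X; have [psi p2] := parameter_exists Y.
move=> /inf_lt[|e [phi' [psi' [p1' p2' ->]]] ed]; last by exists phi', psi'.
by exists (obs phi psi), phi, psi.
Qed.

Lemma dconc_ge0 X Y : 0 <= dconc X Y.
Proof.
have [phi p1] := parameter_exists X; have [psi p2] := parameter_exists Y.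
apply: lb_le_inf; first by exists (obs phi psi), phi, psi.
by move=> r [a [b [_ _ ->]]]; case/andP: (obs_itv a b).
Qed.

(** The values of [f] along [phi] on [I0], placed at the points of [psi], are 1-Lipschitz up to [e],
    hence extend. The exceptional set lies in the complement of [I0]. *)
Lemma coupling_dKF X Y e phi psi I0 f : 0 <= e -> @box_coupling R X Y e phi psi I0 ->
  Lip1 X f -> exists2 g, Lip1 Y g & dKF (f \o phi) (g \o psi) <= e.
Proof.
move=> e0 [p1 p2 [mI sI] lI h] fL.
have [|g gL hg] := @approx_Lip1_extension R Y {s | I0 s} (psi \o sval)
    (f \o phi \o sval) e.
  move=> [s Is] [t It] /=; apply: (le_trans (fL _ _)).
  by have := h s t Is It; rewrite ler_norml; lra.
exists g => //; apply: dKF_le => //.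
apply: (@le_trans _ _ (Leb (I01 `\` I0))).
  apply: Leb_le => s [s01 /= lt]; split => // Is.
  by have := hg (exist _ s Is); rewrite /= distrC; lra.
rewrite Leb_I01D //; move: lI; have := Leb_I01_fin sI.
by case: (Leb I0) => // r _; rewrite !lee_fin; lra.
Qed.

Lemma dconc_iso X Y : mm_iso X Y -> dconc X Y = 0.
Proof.
move=> /mm_iso_coupling[phi [psi [I0 [p1 p2 mI lI h]]]].
have c : @box_coupling R X Y 0 phi psi I0.
  split => //; first by rewrite subr0 lI.
  by move=> s t Is It; rewrite h // subrr normr0.
apply/eqP; rewrite eq_le dconc_ge0 andbT; apply: (le_trans (dconc_le p1 p2)).
apply: (dHaus_le (@dKF_itv R)) => // u.
  by move=> [f fL <-]; have [g gL hg] := coupling_dKF (lexx 0) c fL; exists (g \o psi); split => //; exists g.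
move=> [g gL <-]; have [f fL hf] := coupling_dKF (lexx 0) (box_couplingC c) gL.
exists (f \o phi); split; first by exists f.
move: hf; rewrite (_ : dKF (g \o psi) _ = dKF (f \o phi) (g \o psi)) //.
congr inf; apply/seteqP; split => e [e0 he]; split => //; move: he;
by under eq_set do rewrite distrC.
Qed.

End observable_distance.

(** * Shrinking mm-spaces *)

Section pushforward.
Variables (R : realType) (T T' : Type) (d : T -> T -> R) (d' : T' -> T' -> R).

Lemma lipschitz_mborel_preimage (f : T -> T') (K : R) : 0 < K ->
  (forall x y, d' (f x) (f y) <= K * d x y) ->
  forall B, mborel d' B -> mborel d (f @^-1` B).
Proof.
move=> K0 fK B mB; rewrite -[X in mborel _ X]setTI.
apply: (salg_preimage (sigma_algebra_mborel d)) mB.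
  exact: (salgT (sigma_algebra_mborel d)).
move=> A oA; rewrite setTI; apply: mborel_open => x /oA[r r0 rA].
exists (r / K); first by rewrite divr_gt0.
move=> y; rewrite /mball /= => xy; apply: rA; rewrite /mball /=.
by apply: (le_lt_trans (fK _ _)); rewrite mulrC -ltr_pdivlMr.
Qed.

Lemma pushforward_prob (mu : set T -> \bar R) (f : T -> T') : is_borel_prob d mu ->
  (forall B, mborel d' B -> mborel d (f @^-1` B)) ->
  is_borel_prob d' (fun B => mu (f @^-1` B)).
Proof.
move=> [mu0 mup musadd muT] mf; split.
- by rewrite preimage_set0.
- by move=> A /mf; exact: mup.
- move=> F mF tF; rewrite preimage_bigcup; apply: musadd.
    by move=> n; exact: mf.
  apply/trivIsetP => i j _ _ ij; apply/seteqP; split => // x /= [xi xj].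
  by move/trivIsetP: tF => /(_ i j I I ij) /seteqP[+ _]; apply; split; [exact: xi|].
- by rewrite preimage_setT.
Qed.

End pushforward.

Section point_space.
Variable R : realType.

Let d (x y : unit) : R := 0.

Let d_metric : is_metric d.
Proof. by split => // [[] []|x y z]; rewrite /d ?addr0. Qed.

Let d_complete : complete_metric d.
Proof. by move=> u _; exists tt => e e0; exists 0%N. Qed.

Let d_separable : separable_metric d.
Proof. by exists (fun=> tt) => x e e0; exists 0%N. Qed.

Let d_prob : is_borel_prob d (@dirac _ unit tt R).
Proof.
split.
- by rewrite measure0.
- by move=> A _; exact: measure_ge0.
- move=> F _ tF; have mF (n : nat) : measurable (F n) by [].
  have := @measure_sigma_additive _ _ _ (@dirac _ unit tt R) F mF tF.
  by under eq_fun do rewrite big_mkord.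
- by rewrite diracT.
Qed.

Definition point_space : mmspace R :=
  MMSpace (MMStruct _ _ _ _ d_metric d_complete d_separable d_prob).

Lemma point_dist x y : dist point_space x y = 0. Proof. by []. Qed.

Lemma meas_point B : meas point_space B = (`[< B tt >]%:R : R)%:E.
Proof. by rewrite /meas /= diracE; congr (_%:R%:E); apply/idP/asboolP; rewrite inE. Qed.

Lemma point_param (phi : R -> unit) : @parameter R point_space phi.
Proof.
move=> B _; have [Bt|nB] := pselect (B tt).
  rewrite (_ : phi @^-1` B = setT); last first.
    by apply/seteqP; split => // s _ /=; case: (phi s).
  rewrite setIT meas_point asboolT //; split; first exact: Lmeasurable_I01.
  exact: Leb_I01.
rewrite (_ : phi @^-1` B = set0); last first.
  by apply/seteqP; split => // s /=; case: (phi s).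
rewrite setI0 meas_point asboolF // Leb_set0; split => //.
exact: (salg_set0 (sigma_algebra_Lmeasurable R)).
Qed.

End point_space.
Arguments point_space {R}.

Section scaling.
Variables (R : realType) (t : R).
Hypothesis t0 : 0 < t.
Implicit Type X : mmspace R.

Let d X (x y : mm_T X) : R := t * dist X x y.

Let d_metric X : is_metric (@d X).
Proof.
have [h1 h2 h3 h4] := dist_metric X; split; rewrite /d.
- by move=> x; rewrite h1 mulr0.
- by move=> x y /eqP; rewrite mulf_eq0 gt_eqF //= => /eqP /h2.
- by move=> x y; rewrite h3.
- by move=> x y z; rewrite -mulrDr ler_pM2l.
Qed.

Let d_lt X (x y : mm_T X) e : (d x y < e) = (dist X x y < e / t).
Proof. by rewrite /d ltr_pdivlMr // mulrC. Qed.

Let d_complete X : complete_metric (@d X).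
Proof.
move=> u cu; have [|x hx] := mm_complete (mm_s X) u.
  move=> e e0; have [|N hN] := cu (t * e); first by rewrite mulr_gt0.
  by exists N => m n Nm Nn; have := hN m n Nm Nn; rewrite d_lt mulrAC divff ?mul1r // gt_eqF.
exists x => e e0; have [|N hN] := hx (e / t); first by rewrite divr_gt0.
by exists N => n Nn; rewrite d_lt; exact: hN.
Qed.

Let d_separable X : separable_metric (@d X).
Proof.
have [u hu] := mm_separable (mm_s X); exists u => x e e0.
by have [|n hn] := hu x (e / t); [rewrite divr_gt0|exists n; rewrite d_lt].
Qed.

Lemma mborel_scale X : mborel (@d X) = mborel (dist X).
Proof.
rewrite /mborel; congr smallest; apply/seteqP; split => A oA x /oA[r r0 rA].
  by exists (r / t); [rewrite divr_gt0|move=> y; rewrite /mball /= -d_lt => /rA].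
exists (t * r); first by rewrite mulr_gt0.
by move=> y; rewrite /mball /= d_lt mulrAC divff ?gt_eqF // mul1r => /rA.
Qed.

Let d_prob X : is_borel_prob (@d X) (meas X).
Proof. by have := mm_prob (mm_s X); rewrite /is_borel_prob mborel_scale. Qed.

Definition scale X : mmspace R :=
  MMSpace (MMStruct _ _ _ _ (@d_metric X) (@d_complete X) (@d_separable X) (d_prob X)).

Lemma dist_scale X x y : dist (scale X) x y = t * dist X x y.
Proof. by []. Qed.

Lemma mborel_dist_scale X : mborel (dist (scale X)) = mborel (dist X).
Proof. by rewrite -[RHS]mborel_scale. Qed.

Lemma supp_scale X : supp (scale X) = supp X.
Proof.
have E x r : mball (dist (scale X)) x r = mball (dist X) x (r / t).
  by apply/seteqP; split => y; rewrite /mball /= -d_lt.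
apply/seteqP; split => x /= h r r0.
  by have := h (t * r); rewrite E mulrAC divff ?gt_eqF // mul1r mulr_gt0 //; apply.
by rewrite E; apply: h; rewrite divr_gt0.
Qed.

Lemma scale_iso X Y : mm_iso X Y -> mm_iso (scale X) (scale Y).
Proof.
move=> [f [fiso fS fm]]; exists f; rewrite !supp_scale; split => //.
  by move=> x x' sx sx'; rewrite !dist_scale fiso.
by move=> B; rewrite mborel_dist_scale => /fm.
Qed.

End scaling.

Section shrinking.
Variable R : realType.
Implicit Types (X Y : mmspace R) (t : R).

(** Scaling by 0 does not give a metric, so the contraction ends at [point_space]; this is the same
    space for every [X], which makes its endpoint an equality. *)
Definition shrink X t : mmspace R :=
  match pselect (0 < 1 - t) with
  | left t1 => scale t1 X
  | right _ => point_space
  end.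

Lemma shrink1 X : shrink X 1 = point_space.
Proof. by rewrite /shrink; case: pselect => // t1; exfalso; move: t1; rewrite subrr ltxx. Qed.

Lemma shrink0_iso X : mm_iso (shrink X 0) X.
Proof.
rewrite /shrink; case: pselect => [t1|nt]; last by exfalso; apply: nt; rewrite subr0 ltr01.
exists id; rewrite supp_scale; split; last first.
- by move=> B mB; rewrite preimage_id; exact: meas_suppI.
- by rewrite image_id.
- by move=> x x' _ _; rewrite dist_scale subr0 mul1r.
Qed.

Lemma shrink_iso X Y t : mm_iso X Y -> mm_iso (shrink X t) (shrink Y t).
Proof.
by rewrite /shrink; case: pselect => ? ?; [exact: scale_iso|exact: mm_iso_refl].
Qed.

(** Hides the case distinction of [shrink]: [p] is the identity or the map to the point, and
    suitably Lipschitz functions descend along it. *)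
Lemma shrink_proj X t : t <= 1 -> exists p : mm_T X -> mm_T (shrink X t),
  [/\ forall x y, dist (shrink X t) (p x) (p y) = (1 - t) * dist X x y,
      forall phi, parameter X phi -> parameter (shrink X t) (p \o phi) &
      forall h : mm_T X -> R, (forall x y, `|h x - h y| <= (1 - t) * dist X x y) ->
        exists2 f, Lip1 (shrink X t) f & f \o p = h].
Proof.
move=> t1; rewrite /shrink; case: pselect => [t1'|nt].
  exists id; split => //; last by move=> h hL; exists h.
  by move=> phi pphi B; rewrite mborel_dist_scale => /pphi.
have t1E : t = 1 by apply/eqP; rewrite eq_le t1 /=; move/negP: nt; rewrite -leNgt; lra.
exists (fun=> tt); split.
- by move=> x y; rewrite point_dist t1E subrr mul0r.
- by move=> phi _; exact: point_param.
- move=> h hL; have [x0 _] := supp_nonempty X; exists (fun=> h x0).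
    by move=> x y; rewrite subrr normr0.
  apply/funext => x /=; have := hL x0 x; rewrite t1E subrr mul0r normr_le0 subr_eq0.
  by move/eqP.
Qed.

Lemma shrink_box_continuous X t (e : R) : unitI t -> 0 < e ->
  exists2 del : R, 0 < del & forall Y s, unitI s -> box X Y < del ->
    `|s - t| < del -> box (shrink X t) (shrink Y s) < e.
Proof.
rewrite /unitI /= => t01 e0; have [x0 _] := supp_nonempty X.
have [|D [D0 hD]] := mm_tight x0 (e := e / 4); first lra.
(* Two errors share e / 4: [del] from the coupling, and [2 * D * del] from the change of scale
   applied to distances below 2D. *)
pose del := e / (4 * (1 + 2 * D)).
have D1 : 0 < 4 * (1 + 2 * D) by lra.
have del0 : 0 < del by rewrite divr_gt0.
have delE : del * (1 + 2 * D) = e / 4 by rewrite /del; field; lra.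
have delD : 0 < del * D by rewrite mulr_gt0.
exists del => // Y s s01 /box_lt[e' [phi [psi [I0 [e'0 e'd [p1 p2 [mI sI] lI h]]]]]] st.
have [|p [pd pp _]] := @shrink_proj X t; first lra.
have [|q [qd qp _]] := @shrink_proj Y s; first lra.
pose far := I01 `&` phi @^-1` [set y | (D <= dist X x0 y)%R].
have mfar : Lmeasurable far.
  apply: param_comp_measurable => //.
  rewrite (_ : [set y | _] = ~` mball (dist X) x0 D); last first.
    by apply/seteqP; split => y; rewrite /mball /= leNgt => /negP.
  by apply: (salgC (sigma_algebra_mborel _)); exact: (mborel_mball (dist_metric X)).
apply: (@le_lt_trans _ _ (e / 2)); last lra.
apply: (@box_le _ _ _ _ (p \o phi) (q \o psi) (I0 `\` far)); first lra.
split; [exact: pp|exact: qp| | |].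
- split; first exact: (salgD (sigma_algebra_Lmeasurable R)).
  by move=> x [/sI].
- have := Leb_setU_le (I0 `\` far) far; have := hD _ p1; rewrite -/far => f1 f2.
  have : (Leb I0 <= Leb (I0 `\` far `|` far))%E.
    by apply: Leb_le => x Ix; have [|] := pselect (far x); [right|left].
  move=> /(le_trans lI)/le_trans/(_ f2).
  have : Leb far \is a fin_num by apply: Leb_I01_fin => x [].
  have : Leb (I0 `\` far) \is a fin_num by apply: Leb_I01_fin => x [/sI].
  move: f1; case: (Leb far) => // r1; case: (Leb (I0 `\` far)) => // r2.
  by rewrite -EFinD !lee_fin; lra.
- move=> x y [Ix fx] [Iy fy]; rewrite /= pd qd.
  have nf z : I0 z -> ~ far z -> dist X x0 (phi z) < D.
    by move=> Iz nfz; rewrite ltNge; apply/negP => le; apply: nfz; split => //; exact: sI.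
  have := nf _ Ix fx; have := nf _ Iy fy.
  have := dist_triangle (X := X) x0 (phi x) (phi y); rewrite (dist_sym (phi x) x0).
  have := h _ _ Ix Iy; have := dist_ge0 (phi x) (phi y).
  move: st; rewrite ltr_norml !ler_norml.
  move: (dist X (phi x) (phi y)) (dist Y (psi x) (psi y)) => a b st a0 ab tri fy' fx'.
  have a2D : a < 2 * D by lra.
  have k1 : - (del * (2 * D)) <= (s - t) * a <= del * (2 * D) by nra.
  have k2 : - e' <= (1 - s) * (a - b) <= e' by move: s01; rewrite /unitI /=; nra.
  have -> : (1 - t) * a - (1 - s) * b = (s - t) * a + (1 - s) * (a - b) by ring.
  lra.
Qed.

(** Divide by [a]; the constant [c] serves the case [a = 0], where [h] is constant. *)
Lemma scaled_Lip1 X (a : R) (h : mm_T X -> R) : 0 <= a ->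
  (forall x y, `|h x - h y| <= a * dist X x y) ->
  exists2 f, Lip1 X f & exists c, forall x, h x = a * f x + c.
Proof.
move=> a0 hL; have [a1|a1] := ltP 0 a.
  exists (fun x => a^-1 * h x).
    move=> x y; rewrite -mulrBr normrM gtr0_norm ?invr_gt0 //.
    by rewrite -ler_pdivlMl ?invr_gt0 // invrK.
  by exists 0 => x; rewrite mulrA divff ?gt_eqF // mul1r addr0.
have aE : a = 0 by apply/eqP; rewrite eq_le a1.
have [x0 _] := supp_nonempty X; exists (fun=> 0).
  by move=> x y; rewrite subrr normr0 dist_ge0.
exists (h x0) => x; rewrite mulr0 add0r.
by have := hL x x0; rewrite aE mul0r normr_le0 subr_eq0 => /eqP.
Qed.

Lemma shrink_dconc_continuous X t (e : R) : unitI t -> 0 < e ->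
  exists2 del : R, 0 < del & forall Y s, unitI s -> dconc X Y < del ->
    `|s - t| < del -> dconc (shrink X t) (shrink Y s) < e.
Proof.
rewrite /unitI /= => t01 e0; have [x0 _] := supp_nonempty X.
have [|D [D0 hD]] := mm_tight x0 (e := e / 4); first lra.
pose del := e / (4 * (1 + D)).
have D1 : 0 < 4 * (1 + D) by lra.
have del0 : 0 < del by rewrite divr_gt0.
have delE : del * (1 + D) = e / 4 by rewrite /del; field; lra.
have delD : 0 < del * D by rewrite mulr_gt0.
exists del => // Y s; rewrite /unitI /= => s01 /dconc_lt[phi [psi [p1 p2 ob]]] st.
have [|p [pd pp pl]] := @shrink_proj X t; first lra.
have [|q [qd qp ql]] := @shrink_proj Y s; first lra.
(* [f] is normalised at [x0], so that it is bounded by [D] outside the far set. The exceptional set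
   costs e / 4 for being far and [del] for [f] and [g] differing. *)
have core f g u v : Lip1 X f -> dKF (f \o phi) (g \o psi) < del ->
    (forall r, u r - v r = (s - t) * (f (phi r) - f x0) +
                           (1 - s) * (f (phi r) - g (psi r))) ->
    dKF u v <= e / 2.
  move=> fL /dKF_lt hk uv; apply: dKF_le; first lra.
  apply: (@le_trans _ _ (Leb ((I01 `&` phi @^-1` [set y | (D <= dist X x0 y)%R]) `|`
     (I01 `&` [set r | (del < `|(f \o phi) r - (g \o psi) r|)%R])))).
    apply: Leb_le => r [r01 /=]; rewrite uv => lt.
    have [Dr|rD] := leP D (dist X x0 (phi r)); first by left.
    right; split => //=; rewrite ltNge; apply/negP => le; move: lt; apply/negP.
    rewrite -leNgt; move: le st; rewrite !ler_norml ltr_norml => le st.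
    have := fL (phi r) x0; rewrite dist_sym ler_norml.
    move: (f (phi r) - f x0) (f (phi r) - g (psi r)) le => a b le ha.
    have k1 : - (del * D) <= (s - t) * a <= del * D by nra.
    have k2 : - del <= (1 - s) * b <= del by nra.
    lra.
  apply: (le_trans (Leb_setU_le _ _)).
  apply: (@le_trans _ _ ((e / 4)%:E + del%:E)%E); first exact: leeD (hD _ p1) hk.
  by rewrite -EFinD lee_fin; lra.
apply: (le_lt_trans (dconc_le (pp _ p1) (qp _ p2))).
apply: (@le_lt_trans _ _ (e / 2)); last lra.
apply: (dHaus_le (@dKF_itv R)); first lra.
- move=> u [F FL <-].
  have [||f fL [c hc]] := @scaled_Lip1 X (1 - t) (F \o p).
  + lra.
  + by move=> x y /=; rewrite -pd; exact: FL.
  have [||v [g gL <-] gk] := dHaus_lt_l (@dKF_itv R) _ ob (a := f \o phi).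
  + exact: Lip1_nonempty.
  + by exists f.
  (* The constant [(s - t) * f x0] produces the normalisation at [x0] required by [core]. *)
  have [|G GL GE] := ql (fun y => (1 - s) * g y + (c + (s - t) * f x0)).
    move=> x y; rewrite opprD addrACA subrr addr0 -mulrBr normrM ger0_norm; last lra.
    by apply: ler_wpM2l; [lra|exact: gL].
  exists (G \o (q \o psi)); split; first by exists G.
  apply: (core f g) => // r.
  have -> : (F \o (p \o phi)) r = (F \o p) (phi r) by [].
  have -> : (G \o (q \o psi)) r = (G \o q) (psi r) by [].
  by rewrite hc GE; ring.
- move=> v [G GL <-].
  have [||g gL [c hc]] := @scaled_Lip1 Y (1 - s) (G \o q).
  + lra.
  + by move=> x y /=; rewrite -qd; exact: GL.
  have [||u [f fL <-] gk] := dHaus_lt_r (@dKF_itv R) _ ob (b := g \o psi).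
  + exact: Lip1_nonempty.
  + by exists g.
  have [|F FL FE] := pl (fun y => (1 - t) * f y + (c - (s - t) * f x0)).
    move=> x y; rewrite opprD addrACA subrr addr0 -mulrBr normrM ger0_norm; last lra.
    by apply: ler_wpM2l; [lra|exact: fL].
  exists (F \o (p \o phi)); split; first by exists F.
  apply: (core f g) => // r.
  have -> : (F \o (p \o phi)) r = (F \o p) (phi r) by [].
  have -> : (G \o (q \o psi)) r = (G \o q) (psi r) by [].
  by rewrite hc FE; ring.
Qed.

End shrinking.

Lemma box_contraction (R : realType) :
  contractible (@box R) (@mm_iso R) (fun _ => True) /\
  path_connected (@box R) (@mm_iso R) (fun _ => True) /\
  simply_connected (@box R) (@mm_iso R) (fun _ => True).
Proof.
apply: (contraction_all (H := @shrink R) (x0 := point_space)) => //.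
- move=> X t _ t01 e e0; have [del del0 h] := shrink_box_continuous X t01 e0.
  by exists del => // Y s _; exact: h.
- by move=> X _; exact: shrink0_iso.
- by move=> X _; exact: shrink1.
- by move=> X _; apply: box_iso; exact: mm_iso_refl.
- by move=> X Y _ _; exact: box_iso.
- exact: mm_iso_trans.
- exact: mm_iso_refl.
- by move=> X Y t _ _ _; exact: shrink_iso.
Qed.

Lemma dconc_contraction (R : realType) :
  contractible (@dconc R) (@mm_iso R) (fun _ => True) /\
  path_connected (@dconc R) (@mm_iso R) (fun _ => True) /\
  simply_connected (@dconc R) (@mm_iso R) (fun _ => True).
Proof.
apply: (contraction_all (H := @shrink R) (x0 := point_space)) => //.
- move=> X t _ t01 e e0; have [del del0 h] := shrink_dconc_continuous X t01 e0.
  by exists del => // Y s _; exact: h.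
- by move=> X _; exact: shrink0_iso.
- by move=> X _; exact: shrink1.
- by move=> X _; apply: dconc_iso; exact: mm_iso_refl.
- by move=> X Y _ _; exact: dconc_iso.
- exact: mm_iso_trans.
- exact: mm_iso_refl.
- by move=> X Y t _ _ _; exact: shrink_iso.
Qed.

(** * Pyramids *)

Section push_space.
Variables (R : realType) (X : mmspace R) (T : Type) (d : T -> T -> R).
Hypotheses (md : is_metric d) (cd : complete_metric d) (sd : separable_metric d).
Variable f : mm_T X -> T.
Hypothesis f_lip : forall x y, d (f x) (f y) <= dist X x y.

Let f_borel B : mborel d B -> mborel (dist X) (f @^-1` B).
Proof.
by apply: (lipschitz_mborel_preimage (K := 1)) => // x y; rewrite mul1r.
Qed.

Definition push_struct : mmstruct R T := MMStruct _ _ _ _ md cd sd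
  (pushforward_prob (mm_prob (mm_s X)) f_borel).

Definition push : mmspace R := MMSpace push_struct.

Lemma push_dom : lip_dom push X.
Proof. by exists f. Qed.

Lemma push_param phi : parameter X phi -> parameter push (f \o phi).
Proof. by move=> pphi B /f_borel; exact: pphi. Qed.

Lemma supp_push_near x (r : R) : supp push x -> 0 < r -> exists y, d x (f y) < r.
Proof.
move=> sx r0; have [y _ hy] := supp_meets (X := X)
  (f_borel (mborel_mball md x r)) (sx r r0).
by exists y.
Qed.

End push_space.

Section lipschitz_domination.
Variables (R : realType) (X Y : mmspace R) (f : mm_T X -> mm_T Y).
Hypothesis f_lip : forall x x', dist Y (f x) (f x') <= dist X x x'.
Hypothesis f_push : forall B, mborel (dist Y) B -> meas X (f @^-1` B) = meas Y B.

Let f_borel B : mborel (dist Y) B -> mborel (dist X) (f @^-1` B).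
Proof.
by apply: (lipschitz_mborel_preimage (K := 1)) => // x y; rewrite mul1r.
Qed.

Lemma supp_lip_image x : supp X x -> supp Y (f x).
Proof.
move=> sx r r0; have mB := mborel_mball (dist_metric Y) (f x) r.
rewrite -(f_push mB); apply: (lt_le_trans (sx r r0)); apply: meas_le.
- exact: (mborel_mball (dist_metric X)).
- exact: f_borel.
- by move=> y; rewrite /mball /=; apply: le_lt_trans; exact: f_lip.
Qed.

(** The preimage of a ball about a support point has positive mass, hence meets the support of
    [X]. *)
Lemma supp_lip_near y (r : R) : supp Y y -> 0 < r ->
  exists2 x, supp X x & dist Y y (f x) < r.
Proof.
move=> sy r0; have mB := mborel_mball (dist_metric Y) y r.
by apply: (supp_meets (f_borel mB)); rewrite f_push //; exact: sy.
Qed.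

End lipschitz_domination.

Section product_metric.
Variables (R : realType) (Y Z : mmspace R).

(** The max metric is chosen so that a diameter bound holds in the product as soon as it holds in
    both factors. *)
Definition dprod (p q : mm_T Y * mm_T Z) : R :=
  Num.max (dist Y p.1 q.1) (dist Z p.2 q.2).

Lemma dprod_metric : is_metric dprod.
Proof.
split; rewrite /dprod.
- by move=> x; rewrite !dist_xx maxxx.
- move=> [x x'] [y y'] /= h; have [_ hY _ _] := dist_metric Y; have [_ hZ _ _] := dist_metric Z.
  have : Num.max (dist Y x y) (dist Z x' y') <= 0 by rewrite h.
  rewrite ge_max => /andP[h1 h2]; congr pair; [apply: hY|apply: hZ]; apply/eqP;
  by rewrite eq_le dist_ge0 andbT.
- by move=> x y; rewrite dist_sym (dist_sym x.2).
- move=> x y z; rewrite ge_max; apply/andP; split.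
    apply: (le_trans (dist_triangle y.1 _ _)); apply: lerD; rewrite le_max lexx //.
  by apply: (le_trans (dist_triangle y.2 _ _)); apply: lerD; rewrite le_max lexx orbT.
Qed.

Lemma dprod_complete : complete_metric dprod.
Proof.
move=> u cu.
have [|y hy] := mm_complete (mm_s Y) (fst \o u).
  move=> e /cu[N hN]; exists N => m n Nm Nn.
  by have := hN m n Nm Nn; rewrite /dprod gt_max => /andP[].
have [|z hz] := mm_complete (mm_s Z) (snd \o u).
  move=> e /cu[N hN]; exists N => m n Nm Nn.
  by have := hN m n Nm Nn; rewrite /dprod gt_max => /andP[].
exists (y, z) => e e0; have [N hN] := hy _ e0; have [M hM] := hz _ e0.
exists (maxn N M) => n; rewrite geq_max => /andP[Nn Mn].
by rewrite /dprod gt_max; apply/andP; split; [exact: hN|exact: hM].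
Qed.

Lemma dprod_separable : separable_metric dprod.
Proof.
have [u hu] := mm_separable (mm_s Y); have [v hv] := mm_separable (mm_s Z).
exists (fun n => if @unpickle (nat * nat)%type n is Some ij then (u ij.1, v ij.2)
  else (u 0%N, v 0%N)) => x e e0.
have [i hi] := hu x.1 e e0; have [j hj] := hv x.2 e e0.
by exists (pickle (i, j)); rewrite pickleK /dprod gt_max /=; apply/andP.
Qed.

End product_metric.

(** * Spaces on coordinate vectors with the sup norm *)

Section sup_metric.
Variables (R : realType) (N : nat).
Implicit Types x y : 'rV[R]_N.

Lemma dinf_leP x y (r : R) : 0 <= r ->
  dinf N x y <= r <-> forall i, `|x ord0 i - y ord0 i| <= r.
Proof.
move=> r0; split; last by move=> h; apply: bigmax_le.
by move=> h i; apply: le_trans h; exact: (le_bigmax 0 (fun i => `|x ord0 i - y ord0 i|)).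
Qed.

Lemma dinf_ltP x y (r : R) : 0 < r ->
  dinf N x y < r <-> forall i, `|x ord0 i - y ord0 i| < r.
Proof.
move=> r0; split; last by move=> h; apply: bigmax_lt.
by move=> h i; apply: le_lt_trans h; exact: (le_bigmax 0 (fun i => `|x ord0 i - y ord0 i|)).
Qed.

Lemma dinf_ge0 x y : 0 <= dinf N x y.
Proof.
rewrite /dinf; apply: (big_ind (fun r : R => 0 <= r)) => //.
by move=> a b a0 b0; rewrite le_max a0.
Qed.

Lemma dinf_coord x y i : `|x ord0 i - y ord0 i| <= dinf N x y.
Proof. by move: i; apply/dinf_leP; [exact: dinf_ge0|]. Qed.

Lemma dinf_metric : is_metric (@dinf R N).
Proof.
split.
- move=> x; apply/eqP; rewrite eq_le dinf_ge0 andbT; apply/dinf_leP => // i.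
  by rewrite subrr normr0.
- move=> x y h; apply/rowP => i; apply/eqP; rewrite -subr_eq0 -normr_le0.
  by rewrite -h; exact: dinf_coord.
- by move=> x y; apply: eq_bigr => i _; rewrite distrC.
- move=> x y z; apply/dinf_leP; first by rewrite addr_ge0 ?dinf_ge0.
  move=> i; have := dinf_coord x y i; have := dinf_coord y z i.
  have := ler_normD (x ord0 i - y ord0 i) (y ord0 i - z ord0 i).
  have -> : x ord0 i - y ord0 i + (y ord0 i - z ord0 i) = x ord0 i - z ord0 i by ring.
  lra.
Qed.

Lemma uniform_threshold (Q : 'I_N -> nat -> Prop) :
  (forall i, exists n, forall m, (n <= m)%N -> Q i m) ->
  exists n, forall i m, (n <= m)%N -> Q i m.
Proof.
move=> /choice[f hf]; exists (\max_i f i)%N => i m h; apply: hf.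
by apply: leq_trans h; exact: (leq_bigmax i).
Qed.

Lemma dinf_complete : complete_metric (@dinf R N).
Proof.
move=> u cu.
have /choice[l hl] : forall i, exists l : R, forall e, 0 < e -> exists N0, forall n,
    (N0 <= n)%N -> `|u n ord0 i - l| < e.
  move=> i; have : cvgn (fun n => u n ord0 i).
    apply/cauchy_cvgP; apply: cauchy_exP => e e0; have [M hM] := cu e e0.
    exists (u M ord0 i); exists M => // n /= Mn.
    rewrite /ball /=; have := hM M n (leqnn _) Mn.
    by move/dinf_ltP => /(_ e0).
  move=> c; exists (limn (fun n => u n ord0 i)) => e e0.
  have /cvgrPdist_lt /(_ _ e0)[M _ hM] := c; exists M => n Mn.
  by rewrite distrC; exact: hM.
exists (\row_i l i) => e e0.
have [|M hM] := @uniform_threshold (fun i n => `|u n ord0 i - l i| < e).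
  by move=> i; exact: hl.
by exists M => n Mn; apply/dinf_ltP => // i; rewrite mxE; exact: hM.
Qed.

Lemma dinf_separable : separable_metric (@dinf R N).
Proof.
exists (fun n => if @unpickle 'rV[rat]_N n is Some q then map_mx ratr q else 0).
move=> x e e0.
have /choice[q hq] : forall i, exists q : rat, `|x ord0 i - ratr q| < e.
  move=> i; have [|q] := @rat_in_itvoo R (x ord0 i) (x ord0 i + e); first lra.
  by rewrite in_itv /= => hq; exists q; rewrite ltr_norml; lra.
exists (pickle (\row_i q i)); rewrite pickleK; apply/dinf_ltP => // i.
by rewrite !mxE.
Qed.

End sup_metric.

Section sup_metric_push.
Variables (R : realType) (N : nat) (X : mmspace R) (G : mm_T X -> 'rV[R]_N) (r : R).
Hypothesis G_lip : forall x y, dinf N (G x) (G y) <= dist X x y.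
Hypothesis r0 : 0 <= r.
Hypothesis G_bd : forall x i, `|G x ord0 i| <= r.

Definition push_dinf : mmspace R :=
  push (@dinf_metric R N) (@dinf_complete R N) (@dinf_separable R N) G_lip.

Lemma supp_push_dinf x i : supp push_dinf x -> `|x ord0 i| <= r.
Proof.
move=> sx; apply/ler_addgt0Pr => e e0.
have [y hy] := supp_push_near sx e0.
have := dinf_coord x (G y) i; have := G_bd y i.
have := ler_normD (x ord0 i - G y ord0 i) (G y ord0 i); rewrite subrK.
by move: hy; lra.
Qed.

Lemma push_dinf_inXNR (r' : R) : r <= r' -> inXNR N r' push_dinf.
Proof.
move=> rr'; exists (push_struct (@dinf_metric R N) (@dinf_complete R N)
  (@dinf_separable R N) G_lip); split => //; last exact: mm_iso_refl.
move=> x sx /=; apply/dinf_leP; first exact: le_trans rr'.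
move=> i; rewrite !mxE subr0; apply: le_trans rr'; exact: supp_push_dinf.
Qed.

Lemma push_dinf_diam x y : supp push_dinf x -> supp push_dinf y ->
  dist push_dinf x y <= 2 * r.
Proof.
move=> sx sy; apply/dinf_leP; first by rewrite mulr_ge0.
move=> i; have := supp_push_dinf i sx; have := supp_push_dinf i sy.
have := ler_normB (x ord0 i) (y ord0 i); lra.
Qed.

End sup_metric_push.

(** * Subpyramids of bounded diameter *)

Section thin_pyramids.
Variable R : realType.
Implicit Types (X Y Z : mmspace R) (P Q : mmspace R -> Prop) (t : R).

(* [t * diam (supp Z) <= 1 - t]: no condition at [t = 0], a single point at [t = 1]. *)
Definition thin t Z :=
  forall x x', supp Z x -> supp Z x' -> t * dist Z x x' <= 1 - t.

Definition thin_part P t : mmspace R -> Prop := fun Z => P Z /\ thin t Z.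

Lemma thin_point t : unitI t -> thin t (@point_space R).
Proof. by rewrite /unitI /= => t01 x x' _ _; rewrite point_dist mulr0; lra. Qed.

(** Points of the support of [Y] are limits of images of support points of [X], so the diameter
    cannot grow. *)
Lemma thin_dom t X Y : unitI t -> thin t X -> lip_dom Y X -> thin t Y.
Proof.
rewrite /unitI /= => t01 thX [f [fL fm]] y y' sy sy'.
apply/ler_addgt0Pr => e e0; have e2 : 0 < e / 2 by lra.
have [x sx hx] := supp_lip_near fL fm sy e2.
have [x' sx' hx'] := supp_lip_near fL fm sy' e2.
have := thX x x' sx sx'; have := fL x x'.
have := dist_triangle (f x) y y'; have := dist_triangle (f x') (f x) y'.
rewrite (dist_sym (f x') y').
move: (dist Y y y') (dist X x x') (dist Y (f x) (f x')) hx hx' => a b c hx hx'.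
by move=> *; nra.
Qed.

(** The coupling discards measure at most [e], and [psi] leaves the support on a null set only, so a
    ball of mass above [e] keeps a usable parameter value. *)
Lemma coupling_hits_supp X Y e phi psi I0 x (r : R) :
  @box_coupling R X Y e phi psi I0 -> supp X x -> 0 < r ->
  (e%:E < meas X (mball (dist X) x r))%E ->
  exists s, [/\ I0 s, supp Y (psi s) & dist X x (phi s) < r].
Proof.
move=> [p1 p2 [mI sI] lI h] sx r0; apply: contraPP => ne; apply/negP; rewrite -leNgt.
have [_ <-] := p1 _ (mborel_mball (dist_metric X) x r).
apply: (@le_trans _ _ (Leb ((I01 `\` I0) `|` (I01 `&` psi @^-1` (~` supp Y))))).
  apply: Leb_le => s [s01 /= xs]; have [Is|nI] := pselect (I0 s); last by left.
  by right; split => //= sps; apply: ne; exists s.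
apply: (le_trans (Leb_setU_le _ _)); rewrite param_suppC // adde0 Leb_I01D //.
move: lI; have := Leb_I01_fin sI.
by case: (Leb I0) => // q _; rewrite !lee_fin; lra.
Qed.

Lemma thin_closed t X : unitI t ->
  (forall e : R, 0 < e -> exists2 Y, thin t Y & box X Y < e) -> thin t X.
Proof.
rewrite /unitI /= => t01 hX x x' sx sx'.
apply/ler_addgt0Pr => e e0; have e4 : 0 < e / 4 by lra.
have fin z : meas X (mball (dist X) z (e / 4)) \is a fin_num.
  by apply: (bprob_fin (mm_prob (mm_s X))); exact: (mborel_mball (dist_metric X)).
pose m z : R := fine (meas X (mball (dist X) z (e / 4))).
have mE z : meas X (mball (dist X) z (e / 4)) = (m z)%:E by rewrite fineK.
have m0 z : supp X z -> 0 < m z by move=> sz; rewrite -lte_fin -mE; exact: sz.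
(* The tolerance is below the masses of both balls, so the coupling hits each of them. *)
have [|Y thY] := hX (Num.min (e / 2) (Num.min (m x) (m x'))).
  by rewrite !lt_min !m0 // andbT; lra.
move=> /box_lt[e' [phi [psi [I0 [e'0 + c]]]]]; rewrite !lt_min => /and3P[ee mx mx'].
have [|s [Is ss xs]] := coupling_hits_supp c sx e4; first by rewrite mE lte_fin.
have [|s' [Is' ss' xs']] := coupling_hits_supp c sx' e4; first by rewrite mE lte_fin.
have [_ _ _ _ h] := c; have := h _ _ Is Is'; have := thY _ _ ss ss'.
have := dist_triangle (phi s) x x'; have := dist_triangle (phi s') (phi s) x'.
rewrite (dist_sym (phi s') x') ler_norml.
move: (dist X x x') (dist X (phi s) (phi s')) (dist Y (psi s) (psi s')) xs xs' => a b d xs xs'.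
by move=> *; nra.
Qed.

Lemma point_dom X : lip_dom point_space X.
Proof.
exists (fun=> tt); split; first by move=> x x'; rewrite point_dist dist_ge0.
move=> B _; rewrite meas_point; case: asboolP => Bt.
  by rewrite (_ : _ @^-1` _ = setT) ?meas_setT //; apply/seteqP; split.
by rewrite (_ : _ @^-1` _ = set0) ?meas_set0 //; apply/seteqP; split.
Qed.

(** The support of [Z] is one point, and the constant map to it pushes any probability to that of
    [Z]. *)
Lemma thin1_dom X Z : thin 1 Z -> lip_dom Z X.
Proof.
move=> th; have [z sz] := supp_nonempty Z.
have one y : supp Z y -> y = z.
  move=> sy; have [_ h _ _] := dist_metric Z; apply: h; apply/eqP.
  by rewrite eq_le dist_ge0 andbT; have := th _ _ sy sz; lra.
exists (fun=> z); split; first by move=> x x'; rewrite dist_xx dist_ge0.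
move=> B mB; rewrite -(meas_suppI mB); have [Bz|nB] := pselect (B z).
  rewrite (_ : _ @^-1` _ = setT) ?meas_setT; last by apply/seteqP; split.
  rewrite (_ : supp Z `&` B = supp Z `&` setT).
    by rewrite meas_suppI ?meas_setT //; exact: (salgT (sigma_algebra_mborel _)).
  by apply/seteqP; split => y [sy _]; split => //; rewrite (one y).
rewrite (_ : _ @^-1` _ = set0) ?meas_set0; last by apply/seteqP; split.
rewrite (_ : supp Z `&` B = set0) ?meas_set0 //; apply/seteqP; split => // y [sy].
by rewrite (one y).
Qed.

(** The smallest pyramid, to which all others are contracted. *)
Lemma thin1_pyramid : is_pyramid (thin (1 : R)).
Proof.
split.
- by exists point_space; apply: thin_point; exact: unitI1.
- by move=> X; apply: thin_closed; exact: unitI1.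
- by move=> X Y; apply: thin_dom; exact: unitI1.
- move=> Y Y' tY tY'; exists point_space; split; [|exact: thin1_dom|exact: thin1_dom].
  by apply: thin_point; exact: unitI1.
Qed.

Lemma thin_part0 P : thin_part P 0 = P.
Proof.
apply/funext => Z; apply/propext; split => [[]//|PZ]; split => // x x' _ _.
by rewrite mul0r subr0 ler01.
Qed.

Lemma thin_part1 P : is_pyramid P -> thin_part P 1 = thin 1.
Proof.
move=> [[X PX] _ Pd _]; apply/funext => Z; apply/propext; split => [[]//|tZ].
by split => //; apply: (Pd X) => //; exact: thin1_dom.
Qed.

(** Directedness is the delicate clause: an upper bound in [P] may be too wide, so it is replaced by
    its image in the product of [Y] and [Y'] with the max metric. *)
Lemma thin_part_pyramid P t : unitI t -> is_pyramid P -> is_pyramid (thin_part P t).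
Proof.
move=> t01 [[X0 PX0] Pc Pd Pu]; split.
- by exists point_space; split; [apply: (Pd X0) => //; exact: point_dom|exact: thin_point].
- move=> X hX; split.
    by apply: Pc => e /hX[Y [PY _] XY]; exists Y.
  by apply: thin_closed => // e /hX[Y [_ tY] XY]; exists Y.
- by move=> X Y [PX tX] YX; split; [exact: (Pd X)|exact: thin_dom YX].
- move=> Y Y' [PY tY] [PY' tY']; have [X [PX [f [fL fm]] [f' [fL' fm']]]] := Pu _ _ PY PY'.
  have FL x y : dprod (f x, f' x) (f y, f' y) <= dist X x y.
    by rewrite /dprod ge_max fL fL'.
  pose Z := push (@dprod_metric R Y Y') (@dprod_complete R Y Y') (@dprod_separable R Y Y') FL.
  have fstL (z z' : mm_T Z) : dist Y z.1 z'.1 <= dist Z z z'.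
    by rewrite /dist /= /dprod le_max lexx.
  have sndL (z z' : mm_T Z) : dist Y' z.2 z'.2 <= dist Z z z'.
    by rewrite /dist /= /dprod le_max lexx orbT.
  have fstm B : mborel (dist Y) B -> meas Z (fst @^-1` B) = meas Y B.
    by move=> /fm <-.
  have sndm B : mborel (dist Y') B -> meas Z (snd @^-1` B) = meas Y' B.
    by move=> /fm' <-.
  exists Z; split; [split|by exists fst|by exists snd].
    by apply: (Pd X) => //; exact: push_dom.
  move=> z z' sz sz'.
  have h1 := tY _ _ (supp_lip_image fstL fstm sz) (supp_lip_image fstL fstm sz').
  have h2 := tY' _ _ (supp_lip_image sndL sndm sz) (supp_lip_image sndL sndm sz').
  have -> : dist Z z z' = Num.max (dist Y z.1 z'.1) (dist Y' z.2 z'.2) by [].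
  by case: (leP (dist Y z.1 z'.1) (dist Y' z.2 z'.2)).
Qed.

End thin_pyramids.

(** * Continuity in the weak topology *)

Section radius.
Variables (R : realType) (k : nat).
Hypothesis k0 : (0 < k)%N.
Implicit Types s t : R.

Let kap : R := k%:R.

Let kap1 : 1 <= kap. Proof. by rewrite /kap ler1n. Qed.

(** Makes [radius] equal to min(k, (1 - t) / (2t)) with a denominator that stays at least 1/2, even
    at t = 0. *)
Let den t : R := Num.max (1 - t) (2 * kap * t).

(* The largest [r <= k] such that a ball of radius [r] has diameter [2 r]
   compatible with [thin t]. *)
Definition radius t : R := kap * (1 - t) / den t.

Let den_ge t : unitI t -> 2^-1 <= den t <= 2 * kap.
Proof.
rewrite /unitI /= => t01; have k1 := kap1.
rewrite /den le_max ge_max; apply/andP; split.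
  by have [t2|t2] := leP t 2^-1; apply/orP; [left|right]; nra.
by apply/andP; split; nra.
Qed.

Let radiusE t : unitI t -> radius t * den t = kap * (1 - t).
Proof. by move=> /den_ge h; rewrite /radius divfK //; apply: lt0r_neq0; lra. Qed.

Lemma radius_itv t : unitI t -> 0 <= radius t <= k%:R.
Proof.
move=> ht; have h := den_ge ht; have dp : 0 < den t by lra.
have k1 := kap1; move: ht; rewrite /unitI /= => t01.
rewrite /radius divr_ge0 /=; [|by apply: mulr_ge0; lra|lra].
by rewrite ler_pdivrMr // ler_wpM2l ?le_max ?lexx //; lra.
Qed.

Lemma radius_thin t : unitI t -> t * (2 * radius t) <= 1 - t.
Proof.
move=> ht; have h := den_ge ht; have k1 := kap1; have rE := radiusE ht.
have dk : 2 * kap * t <= den t by rewrite /den le_max lexx orbT.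
have /andP[r0 _] := radius_itv ht.
rewrite -(@ler_pM2l _ kap); last lra.
by rewrite -rE; nra.
Qed.

Lemma radius_max t (l : R) : unitI t -> 0 <= l <= k%:R -> t * (2 * l) <= 1 - t ->
  l <= radius t.
Proof.
move=> ht l0 tl; have h := den_ge ht; have k1 := kap1.
have dp : 0 < den t by lra.
rewrite /radius ler_pdivlMr //; move: ht; rewrite /unitI /= => t01.
rewrite /den; case: (leP (1 - t) (2 * kap * t)) => _; last by move: l0; rewrite -/kap; nra.
by nra.
Qed.

(** After multiplication by [den s], the numerator varies with slope k and the denominator
    contributes k times its slope 2k; since [den s >= 1/2], dividing it out at most doubles the
    bound. *)
Lemma radius_lipschitz s t : unitI s -> unitI t ->
  `|radius s - radius t| <= 2 * k%:R * (1 + 2 * k%:R) * `|s - t|.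
Proof.
move=> hs ht; have h := den_ge hs; have k1 := kap1.
have rs := radiusE hs; have rt := radiusE ht.
have /andP[rt0 rtk] := radius_itv ht; rewrite -/kap in rtk *.
have dd : `|den s - den t| <= 2 * kap * `|s - t|.
  have := ler_norm (s - t); have := ler_norm (- (s - t)); rewrite normrN => n1 n2.
  rewrite /den ler_norml.
  by case: (leP (1 - s)); case: (leP (1 - t)) => *; apply/andP; split; nra.
have E : (radius s - radius t) * den s = kap * (t - s) - radius t * (den s - den t).
  by rewrite mulrBl rs (mulrBr (radius t)) rt; ring.
have : `|radius s - radius t| * den s <= kap * (1 + 2 * kap) * `|s - t|.
  rewrite -{1}(@ger0_norm _ (den s)); last lra.
  rewrite -normrM E; apply: (le_trans (ler_normB _ _)).
  rewrite (normrM kap) (normrM (radius t)) (@ger0_norm _ kap); last lra.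
  rewrite (@ger0_norm _ (radius t)) // (distrC t s).
  have := normr_ge0 (den s - den t); have := normr_ge0 (s - t); nra.
by have := normr_ge0 (radius s - radius t); nra.
Qed.

End radius.

Section coordinate_clamp.
Variable R : realType.
Implicit Types r x y : R.

Definition clampr r x : R := Num.max (- r) (Num.min r x).

Variant clampr_spec r x : R -> Prop :=
| ClampLow of x <= - r : clampr_spec r x (- r)
| ClampMid of - r <= x <= r : clampr_spec r x x
| ClampHigh of r <= x : clampr_spec r x r.

Lemma clamprP r x : 0 <= r -> clampr_spec r x (clampr r x).
Proof.
move=> r0; rewrite /clampr; have [x1|x1] := leP r x.
  by rewrite max_r; [constructor|lra].
have [x2|x2] := leP (- r) x; first by constructor; rewrite x2 ltW.
by constructor; exact: ltW.
Qed.

Lemma clampr_bd r x : 0 <= r -> `|clampr r x| <= r.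
Proof. by move=> r0; rewrite ler_norml; case: clamprP => //; lra. Qed.

Lemma clampr_lip r x y : 0 <= r -> `|clampr r x - clampr r y| <= `|x - y|.
Proof.
move=> r0; have := ler_norm (x - y); have := ler_norm (- (x - y)); rewrite normrN => n1 n2.
by rewrite ler_norml; case: clamprP => // ?; case: clamprP => // ?; lra.
Qed.

(** Clamping is 1-Lipschitz and moves [y], which lies in the interval of radius [r'], by at most
    [|r - r'|]. *)
Lemma clampr_near r r' x y e : 0 <= r -> `|x - y| <= e -> `|y| <= r' ->
  `|clampr r x - y| <= e + `|r - r'|.
Proof.
move=> r0; have := ler_norm (r - r'); have := ler_norm (- (r - r')); rewrite normrN => n1 n2.
by rewrite !ler_norml => xy yr; case: clamprP => // ?; lra.
Qed.

End coordinate_clamp.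

Section pyramid_step.
Variable R : realType.
Implicit Types (P Q : mmspace R -> Prop).

(** A set of diameter at most 2r on the line lies within r of its infimum plus r. *)
Lemma recenter (J : Type) (v : J -> R) (r : R) :
  (forall i j, `|v i - v j| <= 2 * r) -> exists c, forall i, `|v i - c| <= r.
Proof.
move=> h; have [[i0 _]|nJ] := pselect (exists i : J, True); last first.
  by exists 0 => i; case: nJ; exists i.
have lb i : lbound (range v) (v i - 2 * r).
  by move=> _ [j _ <-]; have := h i j; rewrite ler_norml; lra.
exists (inf (range v) + r) => i; rewrite ler_norml.
have : inf (range v) <= v i by apply: ge_inf; [exists (v i - 2 * r)|exists i].
have : v i - 2 * r <= inf (range v) by apply: lb_le_inf => //; exists (v i), i.
lra.
Qed.

Lemma dinf_close N (a a' b b' : 'rV[R]_N) (c : 'I_N -> R) (E : R) : 0 <= E ->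
  (forall i, `|b ord0 i - (a ord0 i - c i)| <= E) ->
  (forall i, `|b' ord0 i - (a' ord0 i - c i)| <= E) ->
  `|dinf N a a' - dinf N b b'| <= 2 * E.
Proof.
move=> E0 h h'.
have k1 : dinf N a a' <= dinf N b b' + 2 * E.
  apply/dinf_leP; first by rewrite addr_ge0 ?dinf_ge0 ?mulr_ge0.
  move=> i; have := dinf_coord b b' i; have := h i; have := h' i.
  by rewrite !ler_norml; lra.
have k2 : dinf N b b' <= dinf N a a' + 2 * E.
  apply/dinf_leP; first by rewrite addr_ge0 ?dinf_ge0 ?mulr_ge0.
  move=> i; have := dinf_coord a a' i; have := h i; have := h' i.
  by rewrite !ler_norml; lra.
by rewrite ler_norml; lra.
Qed.

(* Coordinates of [Y] are transported to [Y'] through the coupling, recentred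
   and clamped; the pushforward of [Y'] under them is dominated by [Y']. *)
Lemma thin_step (k : nat) Q (s t del : R) Y Y' : (0 < k)%N -> is_pyramid Q ->
  unitI s -> unitI t -> thin t Y -> inXNR k k%:R Y -> Q Y' -> box Y Y' < del ->
  exists Z, [/\ thin_part Q s Z, inXNR k k%:R Z &
    box Y Z <= 2 * (del + `|radius k s - radius k t|)].
Proof.
move=> k0 [_ _ Qd _] hs ht tY [S [Sd Ssupp [f [fiso fS fm]]]] QY'.
move=> /box_lt[e [phi [psi [I0 [e0 ed [p1 p2 [mI sI] lI h]]]]]].
have dS x y : dist (MMSpace S) x y = dinf k x y by rewrite /dist /= Sd.
(* Thinness of [Y] and the isometry [f] speak of the support only, so the null set where [phi]
   leaves it is discarded. *)
pose I1 := I0 `&` (I01 `&` phi @^-1` supp Y).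
have mI1 : Lmeasurable I1.
  apply: (salgI (sigma_algebra_Lmeasurable R)) => //.
  by apply: param_comp_measurable => //; exact: mborel_supp.
have lI1 : ((1 - e)%:E <= Leb I1)%E.
  apply: (le_trans lI); rewrite -[leRHS]adde0 -(param_suppC p1).
  apply: le_trans (Leb_setU_le _ _); apply: Leb_le => x Ix; have x01 := sI _ Ix.
  by have [|] := pselect (supp Y (phi x)); [left|right].
have supY (x : {x | I1 x}) : supp Y (phi (sval x)) by have [_ [_]] := svalP x.
have I0x (x : {x | I1 x}) : I0 (sval x) by have [] := svalP x.
have bd (x : {x | I1 x}) i : `|f (phi (sval x)) ord0 i| <= k%:R.
  have : supp (MMSpace S) (f (phi (sval x))) by rewrite -fS; exists (phi (sval x)).
  move=> /Ssupp /= /(le_trans (dinf_coord _ _ i)).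
  by rewrite mxE subr0.
have coord x y i : supp Y x -> supp Y y ->
    `|f x ord0 i - f y ord0 i| <= dist Y x y.
  by move=> sx sy; rewrite -fiso // dS; exact: dinf_coord.
have /choice[c hc] : forall i, exists c, forall x : {x | I1 x},
    `|f (phi (sval x)) ord0 i - c| <= radius k t.
  move=> i; apply: recenter => x y.
  (* Half of a coordinate difference is at most k and, by thinness of [Y], compatible with [t];
     maximality of [radius] then bounds it. *)
  set a := `|_|; suff : a / 2 <= radius k t by lra.
  have a0 : 0 <= a by exact: normr_ge0.
  apply: radius_max => //.
    have := ler_normB (f (phi (sval x)) ord0 i) (f (phi (sval y)) ord0 i).
    by have := bd x i; have := bd y i; rewrite -/a; lra.
  have -> : 2 * (a / 2) = a by field.
  apply: le_trans (tY _ _ (supY x) (supY y)).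
  by apply: ler_wpM2l; [case/andP: ht|exact: coord].
have /choice[g hg] : forall i, exists g, Lip1 Y' g /\ forall x : {x | I1 x},
    `|g (psi (sval x)) - (f (phi (sval x)) ord0 i - c i)| <= e.
  move=> i; have [|g gL hg] := @approx_Lip1_extension R Y' {x | I1 x}
      (psi \o sval) (fun x => f (phi (sval x)) ord0 i - c i) e; last by exists g.
  move=> x y /=; rewrite opprB addrA subrK.
  apply: (le_trans (coord _ _ i (supY x) (supY y))).
  by have := h _ _ (I0x x) (I0x y); rewrite ler_norml; lra.
have /andP[rs0 rsk] := radius_itv k0 hs.
(* Clamping at [radius k s] makes the image thin for [s] and, that radius being at most k, keeps it
   in X(k, k). *)
pose G y : 'rV[R]_k := \row_i clampr (radius k s) (g i y).
have GL x y : dinf k (G x) (G y) <= dist Y' x y.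
  apply/dinf_leP; first exact: dist_ge0.
  move=> i; rewrite !mxE; apply: (le_trans (clampr_lip _ _ rs0)).
  by have [gL _] := hg i; exact: gL.
have Gbd x i : `|G x ord0 i| <= radius k s by rewrite mxE; exact: clampr_bd.
exists (push_dinf GL); split.
- split; first by apply: (Qd Y') => //; exact: push_dom.
  move=> x x' sx sx'; apply: le_trans (radius_thin k0 hs).
  by apply: ler_wpM2l; [case/andP: hs|exact: push_dinf_diam].
- exact: push_dinf_inXNR rsk.
- have r0 := normr_ge0 (radius k s - radius k t).
  apply: (@box_le R Y (push_dinf GL) _ phi (G \o psi) I1); first lra.
  split => //.
  + exact: push_param.
  + by split => // x [_ []].
  + by apply: le_trans lI1; rewrite lee_fin; lra.
  + move=> x y Ix Iy.
    have [_ [_ sx]] := Ix; have [_ [_ sy]] := Iy.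
    rewrite -fiso // dS.
    apply: (@le_trans _ _ (2 * (e + `|radius k s - radius k t|))); last lra.
    (* The translation by [c] cancels in distances, and each of the two endpoints contributes one
       error. *)
    apply: (@dinf_close _ _ _ _ _ c); first lra.
      move=> i; rewrite mxE; apply: clampr_near => //.
        by have [_ /(_ (exist _ x Ix))] := hg i.
      exact: (hc i (exist _ x Ix)).
    move=> i; rewrite mxE; apply: clampr_near => //.
      by have [_ /(_ (exist _ y Iy))] := hg i.
    exact: (hc i (exist _ y Iy)).
Qed.

(** Supplies the nonemptiness required to extract near points from [dHaus]; the constant map to the
    origin provides a witness. *)
Lemma pyramid_meets_inXNR P (k : nat) : is_pyramid P -> exists Y, P Y /\ inXNR k k%:R Y.
Proof.
move=> [[X PX] _ Pd _].
have GL (x y : mm_T X) : dinf k (0 : 'rV[R]_k) 0 <= dist X x y.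
  by have [-> _ _ _] := @dinf_metric R k; exact: dist_ge0.
exists (push_dinf GL); split; first by apply: (Pd X) => //; exact: push_dom.
by apply: (@push_dinf_inXNR _ _ _ _ 0) => // x i; rewrite mxE normr0.
Qed.

End pyramid_step.

(** * The weak metric: convergence of the series and comparison with its terms *)

Section pyramid_metric.
Variable R : realType.
Implicit Types (P Q : mmspace R -> Prop).

Definition rho_weight (k : nat) : R := (2%:R ^- (k + 2)%N) / k%:R.

Definition rho_dist (k : nat) P Q : R :=
  dHaus (@box R) (fun Y => P Y /\ inXNR k k%:R Y) (fun Y => Q Y /\ inXNR k k%:R Y).

Definition rho_partial P Q (n : nat) : R :=
  \sum_(1 <= k < n) (rho_weight k * rho_dist k P Q).

Lemma rhoE P Q : rho P Q = limn (rho_partial P Q). Proof. by []. Qed.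

Lemma rho_dist_itv k P Q : 0 <= rho_dist k P Q <= 1.
Proof. exact: (dHaus_itv (@box_itv R)). Qed.

Lemma rho_weight_gt0 k : (0 < k)%N -> 0 < rho_weight k.
Proof. by move=> k0; rewrite divr_gt0 ?invr_gt0 ?exprn_gt0 ?ltr0n. Qed.

Lemma rho_weight_le k : (0 < k)%N -> rho_weight k <= 2^-1 ^+ k.+1.
Proof.
move=> k0; rewrite /rho_weight ler_pdivrMr ?ltr0n // -exprVn addn2 exprS.
have : 0 < 2^-1 ^+ k.+1 :> R by rewrite exprn_gt0 ?invr_gt0.
have : 1 <= k%:R :> R by rewrite ler1n.
nra.
Qed.

Lemma rho_partial_nd P Q : nondecreasing_seq (rho_partial P Q).
Proof.
apply/nondecreasing_seqP => -[|n]; first by rewrite /rho_partial !big_geq.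
rewrite /rho_partial [leRHS]big_nat_recr //= lerDl mulr_ge0 //; first exact/ltW/rho_weight_gt0.
by case/andP: (rho_dist_itv n.+1 P Q).
Qed.

Lemma rho_partial_le P Q (K : nat) (eta : R) n : 0 <= eta ->
  (forall k, (0 < k < K)%N -> rho_dist k P Q <= eta) ->
  rho_partial P Q n <= eta + 2^-1 ^+ K.
Proof.
move=> eta0 hK; pose p (m : nat) : R := 2^-1 ^+ m.
have p0 m : 0 < p m by rewrite exprn_gt0 ?invr_gt0.
have pS m : p m.+1 = p m / 2 by rewrite /p exprS mulrC.
(* Induction invariant. The weight of index k is at most [p k.+1], and these bounds telescope: over
   all indices below n they sum to less than [1 - p n], over those from K on to [p K - p n]. *)
suff : rho_partial P Q n <= eta * (1 - p n) + (if (K <= n)%N then p K - p n else 0).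
  move=> h; apply: (le_trans h); have := p0 n; have := p0 K; rewrite -/(p K).
  by case: ifP => _; nra.
elim: n => [|n IH].
  rewrite /rho_partial big_geq //= /p expr0 subrr mulr0 add0r.
  by case: ifP => //; rewrite leqn0 => /eqP ->; rewrite subrr.
case: n IH => [|n] IH.
  rewrite /rho_partial big_geq //.
  have p1 : p 1%N = 2^-1 by rewrite /p expr1.
  have [K1|K1] := leqP K 1.
    have : p 1%N <= p K by rewrite /p; case: K {hK IH} K1 => [|[|]] // _; rewrite expr1 expr0; lra.
    by rewrite p1 => h; nra.
  by rewrite p1; nra.
rewrite /rho_partial big_nat_recr //= -/(rho_partial P Q n.+1).
have w := @rho_weight_le n.+1 isT; have w0 := @rho_weight_gt0 n.+1 isT.
have /andP[d0 d1] := rho_dist_itv n.+1 P Q.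
rewrite -/(p n.+2) in w; have pn := pS n.+1; have pn0 := p0 n.+1.
have [Kn|nK] := leqP K n.+1.
  rewrite Kn in IH; rewrite (leq_trans Kn (leqnSn _)).
  have wd : rho_weight n.+1 * rho_dist n.+1 P Q <= p n.+2 by nra.
  nra.
rewrite leqNgt nK /= in IH.
have hd : rho_dist n.+1 P Q <= eta by apply: hK.
have wd : rho_weight n.+1 * rho_dist n.+1 P Q <= p n.+2 * eta by nra.
have [Kn|_] := leqP K n.+2; last nra.
have -> : K = n.+2 by apply/eqP; rewrite eqn_leq Kn.
by rewrite subrr; nra.
Qed.

Lemma rho_partial_cvg P Q : cvgn (rho_partial P Q).
Proof.
apply: nondecreasing_is_cvgn; first exact: rho_partial_nd.
exists (1 + 2^-1 ^+ 0) => _ [n _ <-]; apply: rho_partial_le => // k _.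
by case/andP: (rho_dist_itv k P Q).
Qed.

Lemma rho_le P Q (K : nat) (eta : R) : 0 <= eta ->
  (forall k, (0 < k < K)%N -> rho_dist k P Q <= eta) -> rho P Q <= eta + 2^-1 ^+ K.
Proof.
move=> eta0 hK; rewrite rhoE; apply: limr_le; first exact: rho_partial_cvg.
by apply: nearW => n; exact: rho_partial_le.
Qed.

(** All terms of the series are nonnegative, so each is bounded by the sum. *)
Lemma rho_dist_lt P Q k (eta : R) : (0 < k)%N -> rho P Q < rho_weight k * eta ->
  rho_dist k P Q < eta.
Proof.
move=> k0 h; rewrite -(ltr_pM2l (rho_weight_gt0 k0)); apply: le_lt_trans h.
rewrite rhoE; apply: le_trans (nondecreasing_cvgn_le (rho_partial_nd P Q)
  (@rho_partial_cvg P Q) k.+1).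
rewrite /rho_partial big_nat_recr //= lerDr big_nat; apply: sumr_ge0 => i /andP[i0 _].
rewrite mulr_ge0 //; first exact/ltW/rho_weight_gt0.
by case/andP: (rho_dist_itv i P Q).
Qed.

End pyramid_metric.

Section pyramid_contraction.
Variable R : realType.
Implicit Types (P Q : mmspace R -> Prop).

(** [thin_step] is applied in both directions: from [P] at [t] to [Q] at [s], and back. *)
Lemma rho_dist_thin_part P Q (k : nat) (s t eta : R) : (0 < k)%N ->
  is_pyramid P -> is_pyramid Q -> unitI s -> unitI t ->
  rho_dist k P Q < eta ->
  rho_dist k (thin_part P t) (thin_part Q s) <=
    2 * (eta + `|radius k s - radius k t|).
Proof.
move=> k0 pP pQ hs ht hd.
have /andP[d0 _] := rho_dist_itv k P Q.
apply: (dHaus_le (@box_itv R)).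
- by apply: mulr_ge0 => //; apply: addr_ge0 => //; lra.
- move=> Y [[PY tY] YX].
  have [|Y' [QY' _] YY'] := dHaus_lt_l (@box_itv R) _ hd (conj PY YX).
    exact: pyramid_meets_inXNR.
  have [Z [tZ ZX YZ]] := thin_step k0 pQ hs ht tY YX QY' YY'.
  by exists Z.
- move=> Y [[QY tY] YX].
  have [|Y' [PY' _] YY'] := dHaus_lt_r (@box_itv R) _ hd (conj QY YX).
    exact: pyramid_meets_inXNR.
  rewrite box_sym in YY'.
  have [Z [tZ ZX YZ]] := thin_step k0 pP ht hs tY YX PY' YY'.
  by exists Z; split => //; rewrite box_sym distrC.
Qed.

Lemma rho_dist_thin_part_small P (t : R) (K : nat) (eta : R) :
  is_pyramid P -> unitI t -> 0 < eta ->
  exists2 del : R, 0 < del & forall Q s, is_pyramid Q -> unitI s ->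
    rho P Q < del -> `|s - t| < del ->
    forall k, (0 < k < K)%N -> rho_dist k (thin_part P t) (thin_part Q s) <= eta.
Proof.
move=> pP ht eta0; elim: K => [|K [del del0 IH]].
  by exists 1 => // Q s _ _ _ _ k; rewrite ltn0 andbF.
have [->|K0] := posnP K.
  by exists 1 => // Q s _ _ _ _ k; rewrite ltnS leqn0 lt0n => /andP[/negbTE ->].
pose L : R := 2 * K%:R * (1 + 2 * K%:R).
have K1 : 1 <= K%:R :> R by rewrite ler1n.
have L0 : 0 < L by rewrite /L; nra.
have w0 := @rho_weight_gt0 R _ K0.
(* One quarter of [eta] goes to the distance of the pyramids, one to the change of radius;
   [thin_step] doubles their sum. *)
exists (Num.min del (Num.min (rho_weight R K * (eta / 4)) (eta / 4 / L))).
  by rewrite !lt_min del0 !mulr_gt0 ?invr_gt0 //; lra.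
move=> Q s pQ hs; rewrite !lt_min => /and3P[r1 r2 _] /and3P[s1 _ s3] k /andP[k0].
rewrite ltnS leq_eqVlt => /predU1P[->|kK]; last by apply: IH => //; rewrite k0.
apply: (le_trans (rho_dist_thin_part K0 pP pQ hs ht (rho_dist_lt K0 r2))).
have := radius_lipschitz K0 hs ht; rewrite -/L.
by move: s3; rewrite ltr_pdivlMr // mulrC; lra.
Qed.

(** Terms from K on contribute at most 2^-K, below e / 2; the finitely many others are handled by a
    common modulus. *)
Lemma thin_part_continuous P (t e : R) : is_pyramid P -> unitI t -> 0 < e ->
  exists2 del : R, 0 < del & forall Q s, is_pyramid Q -> unitI s ->
    rho P Q < del -> `|s - t| < del -> rho (thin_part P t) (thin_part Q s) < e.
Proof.
move=> pP ht e0; have e2 : 0 < e / 2 by lra.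
have [K _ /(_ K (leqnn _)) /= hK] := near_infty_natSinv_expn_lt (PosNum e2).
have [del del0 h] := rho_dist_thin_part_small K pP ht e2.
exists del => // Q s pQ hs r st.
apply: (le_lt_trans (rho_le (ltW e2) (h Q s pQ hs r st))).
by move: hK; rewrite exprVn div1r /=; lra.
Qed.

Lemma rho_refl P : rho P P = 0.
Proof.
have dd k : rho_dist k P P = 0.
  apply/eqP; rewrite eq_le; case/andP: (rho_dist_itv k P P) => -> _; rewrite andbT.
  apply: (dHaus_le (@box_itv R)) => // Y YP; exists Y;
  by rewrite box_iso //; exact: mm_iso_refl.
rewrite rhoE (_ : rho_partial P P = fun=> 0) ?lim_cst //.
by apply/funext => n; rewrite /rho_partial big1 // => k _; rewrite dd mulr0.
Qed.

Lemma rho_contraction :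
  contractible (@rho R) (fun P Q => P = Q) (@is_pyramid R) /\
  path_connected (@rho R) (fun P Q => P = Q) (@is_pyramid R) /\
  simply_connected (@rho R) (fun P Q => P = Q) (@is_pyramid R).
Proof.
apply: (contraction_all (H := @thin_part R) (x0 := thin 1)) => //.
- by move=> P t pP ht; exact: thin_part_pyramid.
- by move=> P t pP ht e e0; exact: thin_part_continuous.
- by move=> P _; exact: thin_part0.
- exact: thin_part1.
- by move=> P _; exact: rho_refl.
- by move=> P Q _ _ ->; exact: rho_refl.
- by move=> P Q Q' -> ->.
- exact: thin1_pyramid.
- by move=> P Q t _ _ _ ->.
Qed.

End pyramid_contraction.

Theorem theorem1p4 (R : realType) :
  [/\ (* X with the box topology *)
      contractible (@box R) (@mm_iso R) (fun _ => True) /\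
      path_connected (@box R) (@mm_iso R) (fun _ => True) /\
      simply_connected (@box R) (@mm_iso R) (fun _ => True),
      (* X with the concentration topology *)
      contractible (@dconc R) (@mm_iso R) (fun _ => True) /\
      path_connected (@dconc R) (@mm_iso R) (fun _ => True) /\
      simply_connected (@dconc R) (@mm_iso R) (fun _ => True) &
      (* Pi with the weak topology *)
      contractible (@rho R) (fun P Q => P = Q) (@is_pyramid R) /\
      path_connected (@rho R) (fun P Q => P = Q) (@is_pyramid R) /\
      simply_connected (@rho R) (fun P Q => P = Q) (@is_pyramid R)].
Proof.
split.
- exact: box_contraction.
- exact: dconc_contraction.
- exact: rho_contraction.
Qed.
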